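(* Let $Y=S_{\mathrm{samp}}+\Sigma^{1/2}X\in\mathbb{R}^{p\times N}$, where the noise and the signal satisfy the following. Noise: $p,N\to\infty$ with $p/N\to\varphi\in(0,\infty)$; the entries $x_{i\mu}$ of $X$ are independent with $\mathbb{E}x_{i\mu}=0$, $\mathrm{Var}(x_{i\mu})=1$, $\mathbb{E}x_{i\mu}^3=0$, and $\|x_{i\mu}\|_{\psi_2}\le K$ for a constant $K<\infty$; the matrix $\Sigma=\mathrm{diag}(\sigma_1,\dots,\sigma_p)$ is deterministic and piecewise constant, i.e. there is a partition of $\{1,\dots,p\}$ into consecutive blocks $I_1,\dots,I_{K_p}$ with $\sigma_i=\tau_j$ for $i\in I_j$, $0<\sigma_{\min}\le\tau_j\le\sigma_{\max}<\infty$ (constants), $K_p=o(p)$, and $\min_j|I_j|\to\infty$. Signal: the columns $S_1,\dots,S_N$ of $S_{\mathrm{samp}}$ are i.i.d. from $\rho=\mathbb P\circ\iota^{-1}$, where $(\mathcal M,g)$ is a connected compact $m$-dimensional Riemannian manifold, $\iota:\mathcal M\to\mathbb{R}^p$ is an isometric embedding whose image has linear span of dimension $n\le p$, with $n$ known and not depending on $N,p$, and $\mathbb P$ is a Borel probability measure on $\mathcal M$ with a density with respect to Riemannian volume lying in $[c_{\min},c_{\max}]\subset(0,\infty)$. Let $\sigma=(\sigma_1,\dots,\sigma_p)^\top$ be the diagonal of $\Sigma$. Let $\widehat\sigma^{\mathrm{pwc}}$ be the Potts-smoothed noise variance estimator defined in the context, with penalty $\beta=c\,\frac{\log p}{N}$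 for a constant $c>0$. Then with probability $1-o(1)$, $$\frac1p\bigl\|\widehat\sigma^{\mathrm{pwc}}-\sigma\bigr\|_2^2\ \lesssim\ \frac{\log p}{N},$$ where $\lesssim$ means inequality up to a multiplicative constant independent of $N,p$.
   Context: Model: $Y=S_{\mathrm{samp}}+\Sigma^{1/2}X\in\mathbb{R}^{p\times N}$, $S_{\mathrm{samp}}=[S_1,\dots,S_N]$, with $S_{\mathrm{samp}}$ independent of $X=[x_{i\mu}]$, and data centered ($\mathbb{E}[S_i]=0$). Noise: $p,N\to\infty$ with $p/N\to\varphi\in(0,\infty)$; the entries $x_{i\mu}$ are independent, $\mathbb{E}x_{i\mu}=0$, $\mathrm{Var}(x_{i\mu})=1$, $\mathbb{E}x_{i\mu}^3=0$, and $\|x_{i\mu}\|_{\psi_2}\le K$ for a constant $K<\infty$, where $\|x\|_{\psi_2}=\inf\{t>0:\mathbb{E}\exp(x^2/t^2)\le2\}$. The matrix $\Sigma=\mathrm{diag}(\sigma_1,\dots,\sigma_p)$ is deterministic and piecewise constant: there is a partition of $\{1,\dots,p\}$ into consecutive blocks $I_1,\dots,I_{K_p}$ with $\sigma_i=\tau_j$ for $i\in I_j$, $0<\sigma_{\min}\le\tau_j\le\sigma_{\max}<\infty$ (constants), $K_p=o(p)$, and $\min_j|I_j|\to\infty$. Signal: $(\mathcal M,g)$ is a connected compact $m$-dimensional Riemannian manifold, $\iota:\mathcal M\to\mathbb{R}^p$ an isometric embedding, with $n\le p$ the dimension of the linear span of $\iota(\mathcal M)$; $\mathbb P$ is a Borel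 probability measure on $\mathcal M$ with a density with respect to Riemannian volume lying in $[c_{\min},c_{\max}]\subset(0,\infty)$; $\rho=\mathbb P\circ\iota^{-1}$; $S_1,\dots,S_N$ are i.i.d. from $\rho$. The number $n$ is known and does not depend on $N,p$. Estimator: Let $Q=\frac1N YY^\top$, and let $\widehat C_n$ be the best rank-$n$ approximation of $Q$ (truncation to the leading $n$ eigenvalues and eigenvectors). Let $\widehat\sigma_i=(Q-\widehat C_n)_{ii}$. For $\beta>0$ let $$\widehat\sigma^{\mathrm{pwc}}\in\arg\min_{\tau\in\mathbb{R}^p}\Bigl\{\sum_{i=1}^p(\widehat\sigma_i-\tau_i)^2+\beta\,\#\{1\le i<p:\tau_{i+1}\ne\tau_i\}\Bigr\}.$$ *)

(* Defs.v *)
From HB Require Import structures.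
From mathcomp Require Import all_boot all_order all_algebra.
From mathcomp Require Import all_classical all_reals all_analysis.

Set Implicit Arguments.
Unset Strict Implicit.
Unset Printing Implicit Defensive.

Import Order.TTheory GRing.Theory Num.Theory.
Import numFieldNormedType.Exports.

Local Open Scope classical_set_scope.
Local Open Scope ring_scope.

Notation borelType U := (g_sigma_algebraType (@open U)).

Definition partial (R : realType) (m : nat) (a : 'I_m) (f : 'rV[R]_m -> R)
    (x : 'rV[R]_m) : R :=
  'D_(delta_mx 0 a) f x.

Definition iter_partial (R : realType) (m : nat) (s : seq 'I_m)
    (f : 'rV[R]_m -> R) : 'rV[R]_m -> R :=
  foldr (@partial R m) f s.

(* [f] is C^oo on [U]; meaningful for [U] open, in which case the values of
   [f] outside [U] play no role. *)
Definition smooth_on (R : realType) (m : nat) (U : set 'rV[R]_m)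
    (f : 'rV[R]_m -> R) : Prop :=
  forall (s : seq 'I_m) (x : 'rV[R]_m), U x ->
    {for x, continuous (iter_partial s f)} /\
    forall a : 'I_m, derivable (iter_partial s f) x (delta_mx 0 a).

(* [coord i] is only meaningful on [dom i], and [param i], its inverse, only on
   [coord i @` dom i].  The atlas need not be maximal. *)
Record smooth_atlas (R : realType) (m : nat) (M : ptopologicalType) := SmoothAtlas {
  chart : Type ;
  dom : chart -> set M ;
  coord : chart -> M -> 'rV[R]_m ;
  param : chart -> 'rV[R]_m -> M ;
  dom_open : forall i, open (dom i) ;
  dom_cover : forall x : M, exists i, dom i x ;
  codom_open : forall i, open (coord i @` dom i) ;
  paramK : forall i (x : M), dom i x -> param i (coord i x) = x ;
  coord_continuous : forall i (x : M), dom i x -> {for x, continuous (coord i)} ;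
  param_continuous : forall i (y : 'rV[R]_m), (coord i @` dom i) y ->
    {for y, continuous (param i)} ;
  transition_smooth : forall i j (c : 'I_m),
    smooth_on [set y | (coord i @` dom i) y /\ dom j (param i y)]
      (fun y => coord j (param i y) 0 c)
}.

Definition chart_codom (R : realType) (m : nat) (M : ptopologicalType)
    (A : smooth_atlas R m M) (i : chart A) : set 'rV[R]_m :=
  coord i @` dom i.

(* [jacobian h y] has (a, c) entry d h_c / d y_a (row-vector convention). *)
Definition jacobian (R : realType) (m q : nat) (h : 'rV[R]_m -> 'I_q -> R)
    (y : 'rV[R]_m) : 'M[R]_(m, q) :=
  \matrix_(a, c) partial a (fun z => h z c) y.

(* [gram i y] is the matrix of g(d/dy_a, d/dy_b) in the chart [i]. *)
Record riemannian_metric (R : realType) (m : nat) (M : ptopologicalType)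
    (A : smooth_atlas R m M) := RiemannianMetric {
  gram : chart A -> 'rV[R]_m -> 'M[R]_m ;
  gram_smooth : forall i a b, smooth_on (chart_codom i) (fun y => gram i y a b) ;
  gram_sym : forall i y, chart_codom i y -> (gram i y)^T = gram i y ;
  gram_pos : forall i y, chart_codom i y -> forall v : 'rV[R]_m, v != 0 ->
    0 < (v *m gram i y *m v^T) 0 0 ;
  gram_transition : forall i j y, chart_codom i y -> dom j (param i y) ->
    let J := jacobian (fun z c => coord j (param i z) 0 c) y in
    gram i y = J *m gram j (coord j (param i y)) *m J^T
}.

(* A smooth topological embedding with iota^* (Euclidean metric) = g; being an
   immersion follows from the positivity of g. *)
Definition isometric_embedding (R : realType) (m : nat) (M : ptopologicalType)
    (A : smooth_atlas R m M) (g : riemannian_metric A) (p : nat)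
    (iota : M -> 'cV[R]_p) : Prop :=
  [/\ injective iota,
      forall U : set M,
        open U <-> exists2 V : set 'cV[R]_p, open V & U = iota @^-1` V,
      forall (i : chart A) (l : 'I_p), smooth_on (chart_codom i) (fun y => iota (param i y) l 0)
    & forall (i : chart A) y, chart_codom i y ->
        let J := jacobian (fun z l => iota (param i z) l 0) y in
        gram g i y = J *m J^T].

(* The integral over R^m with respect to Lebesgue measure, as an iterated
   integral; to be applied to nonnegative Borel functions only. *)
Fixpoint lebesgue_integral_rV (R : realType) (m : nat) :
    ('rV[R]_m -> \bar R) -> \bar R :=
  match m return ('rV[R]_m -> \bar R) -> \bar R with
  | 0 => fun f => f 0
  | m'.+1 => fun f =>
      (\int[@lebesgue_measure R]_t
         lebesgue_integral_rV
           (fun y : 'rV[R]_m' => f (row_mx (t%:M : 'M[R]_1) y)))%E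
  end.

(* On a second countable manifold this determines the measure [vol]. *)
Definition riemannian_volume (R : realType) (m : nat) (M : ptopologicalType)
    (A : smooth_atlas R m M) (g : riemannian_metric A)
    (vol : {measure set (borelType M) -> \bar R}) : Prop :=
  forall (i : chart A) (B : set (borelType M)), measurable B -> B `<=` dom i ->
    vol B = lebesgue_integral_rV
      (fun y => (\1_(coord i @` B) y * Num.sqrt (\det (gram g i y)))%:E).

Definition density_between (R : realType) (M : ptopologicalType)
    (vol : {measure set (borelType M) -> \bar R})
    (PM : probability (borelType M) R) (c_min c_max : R) : Prop :=
  exists f : borelType M -> R,
    [/\ measurable_fun setT f,
        forall x, c_min <= f x <= c_max
      & forall B, measurable B -> PM B = (\int[vol]_(x in B) (f x)%:E)%E].

Definition linear_span_dim (R : realType) (p n : nat) (E : set 'cV[R]_p) : Prop :=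
  exists U : {vspace 'cV[R]_p},
    [/\ forall v, E v -> v \in U,
        forall W : {vspace 'cV[R]_p}, (forall v, E v -> v \in W) -> (U <= W)%VS
      & \dim U = n].

Definition mutually_independent (R : realType) (d d' : measure_display)
    (T : measurableType d) (P : probability T R) (U : measurableType d')
    (I : finType) (f : I -> T -> U) : Prop :=
  forall (J : {set I}) (B : I -> set U), (forall i, measurable (B i)) ->
    P [set w | forall i, i \in J -> B i (f i w)] =
    (\prod_(i in J) P (f i @^-1` B i))%E.

Definition independent_pair (R : realType) (d d1 d2 : measure_display)
    (T : measurableType d) (P : probability T R)
    (U1 : measurableType d1) (U2 : measurableType d2)
    (f1 : T -> U1) (f2 : T -> U2) : Prop :=
  forall (B1 : set U1) (B2 : set U2), measurable B1 -> measurable B2 ->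
    P ((f1 @^-1` B1) `&` (f2 @^-1` B2)) =
    (P (f1 @^-1` B1) * P (f2 @^-1` B2))%E.

(* Extended-real valued, so that the infimum of the empty set is +oo. *)
Definition psi2_norm (R : realType) (d : measure_display) (T : measurableType d)
    (P : probability T R) (x : T -> R) : \bar R :=
  ereal_inf [set t%:E | t in
    [set t : R | 0 < t /\
       ('E_P[fun w => expR (x w ^+ 2 / t ^+ 2)%R] <= 2%:E)%E]].

Definition noise_matrix (R : realType) (d : measure_display) (T : measurableType d)
    (P : probability T R) (p N : nat) (K : R) (X : T -> 'M[R]_(p, N)) : Prop :=
  [/\ forall i mu, measurable_fun setT (fun w => X w i mu),
      mutually_independent P (fun (e : 'I_p * 'I_N) w => X w e.1 e.2)
    & forall i mu, let x := fun w => X w i mu in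
        [/\ ('E_P[x] = 0)%E, ('V_P[x] = 1)%E,
            ('E_P[fun w => (x w ^+ 3)%R] = 0)%E & (psi2_norm P x <= K%:E)%E]].

(* [blocks] is the partition {I_1, ..., I_{K_p}} and [tau B] the common value of
   sigma on the block [B]. *)
Definition piecewise_constant (R : realType) (p : nat) (s_min s_max : R)
    (blocks : {set {set 'I_p}}) (sigma : 'rV[R]_p) : Prop :=
  [/\ finset.partition blocks [set: 'I_p],
      forall (B : {set 'I_p}) (i l j : 'I_p), B \in blocks ->
        i \in B -> j \in B -> (i <= l <= j)%N -> l \in B
    & exists tau : {set 'I_p} -> R,
        forall B, B \in blocks ->
          s_min <= tau B <= s_max /\ forall i, i \in B -> sigma 0 i = tau B].

Definition signal_matrix (R : realType) (d : measure_display) (T : measurableType d)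
    (P : probability T R) (M : ptopologicalType) (PM : probability (borelType M) R)
    (p N : nat) (iota : M -> 'cV[R]_p) (S : T -> 'M[R]_(p, N)) : Prop :=
  let column (mu : 'I_N) (w : T) : borelType 'cV[R]_p := col mu (S w) in
  [/\ forall mu, measurable_fun setT (column mu),
      mutually_independent P column,
      forall mu (B : set (borelType 'cV[R]_p)), measurable B ->
        P (column mu @^-1` B) = PM (iota @^-1` B)
    & forall mu (i : 'I_p), ('E_P[fun w => S w i mu] = 0)%E].

Definition observation (R : realType) (p N : nat) (sigma : 'rV[R]_p)
    (S X : 'M[R]_(p, N)) : 'M[R]_(p, N) :=
  S + diag_mx (map_mx Num.sqrt sigma) *m X.

Definition sample_covariance (R : realType) (p N : nat) (Y : 'M[R]_(p, N)) : 'M[R]_p :=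
  (N%:R)^-1 *: (Y *m Y^T).

(* [C] is a truncation of the symmetric matrix [Q] to its [n] leading eigenvalues
   and eigenvectors.  A relation rather than a function, since it is unique only
   when the eigenvalues of ranks n and n+1 differ. *)
Definition spectral_truncation (R : realType) (p n : nat) (Q C : 'M[R]_p) : Prop :=
  exists (V : 'M[R]_p) (lambda : 'rV[R]_p),
    [/\ V *m V^T = 1%:M,
        forall i j : 'I_p, (i <= j)%N -> lambda 0 j <= lambda 0 i,
        Q = V *m diag_mx lambda *m V^T
      & C = V *m diag_mx (\row_i (if (i < n)%N then lambda 0 i else 0)) *m V^T].

Definition residual_variance (R : realType) (p : nat) (Q C : 'M[R]_p) : 'rV[R]_p :=
  \row_i (Q - C) i i.

Definition jumps (R : realType) (p : nat) (tau : 'rV[R]_p) : nat :=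
  #|[set e : 'I_p * 'I_p | (e.2 == e.1.+1 :> nat) && (tau 0 e.2 != tau 0 e.1)]|.

Definition sqdist (R : realType) (p : nat) (u v : 'rV[R]_p) : R :=
  \sum_i (u 0 i - v 0 i) ^+ 2.

Definition potts (R : realType) (p : nat) (beta : R) (u tau : 'rV[R]_p) : R :=
  sqdist u tau + beta * (jumps tau)%:R.

Definition potts_argmin (R : realType) (p : nat) (beta : R) (u tau : 'rV[R]_p) : Prop :=
  forall tau' : 'rV[R]_p, potts beta u tau <= potts beta u tau'.

(* Main.v *)
Require Import Defs.
From HB Require Import structures.
From mathcomp Require Import all_boot all_order all_algebra.
From mathcomp Require Import all_classical all_reals all_analysis.
From mathcomp Require Import measurable_realfun.
From mathcomp Require finmap.
From mathcomp Require Import ring lra.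

Set Implicit Arguments.
Unset Strict Implicit.
Unset Printing Implicit Defensive.

Import Order.TTheory GRing.Theory Num.Theory.
Import numFieldNormedType.Exports.
Local Open Scope classical_set_scope.
Local Open Scope ring_scope.

(** Write [Z = Sigma^(1/2) X] and [W = Z Z^T / N].  The argmin property of the Potts
functional reduces the claim to a bound on the raw residual variances: comparing with
[sigma] itself costs at most [beta * p] for the jumps.  The residual error splits as
[(W_ii - sigma_i) + D_ii] with [D = Q - Chat - W].
- Each [W_ii - sigma_i] is an average of [N] centred subexponential variables, so Chernoff
  and a union bound over [i] give [O(sqrt (log p / N))].
- Almost surely the columns of the signal lie in a fixed [n]-dimensional space, so [D] has
  rank at most [3 n], and its operator norm is [O(1)]: eigenvalue [n + 1] of [Q] is at most
  the top eigenvalue of [W] (test on a vector orthogonal to the signal), which is bounded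
  by a net argument.  Hence [sum_i D_ii^2] is at most the squared Frobenius norm, which is
  [O(n)], negligible against [p * log p / N]. *)

(** [Chat] and [sigma_pwc] are arbitrary functions of the sample point: truncations and minimisers
    need not be unique, and no measurability is assumed of them. Probability is therefore confined
    to three measurable exceptional sets that depend on [X] and [Ssamp] only; off these sets the
    bound is a deterministic inequality, valid for every truncation and every minimiser.

    The jump cost is harmless because [beta] is itself [c] times the target rate. For [D] the
    operator norm alone would only give a sum of order [p]. The low rank replaces [p] by [3 n], and
    after division by [p] a constant is of order [1 / p], which is within the rate because [p / N]
    stays above [phi / 2] and [ln p >= 1].

    Independence is given for events only, so the product formula for expectations behind Chernoff's
    bound has to be built from it. The net consists of rescaled integer vectors, which can be
    counted by a binomial coefficient. *)

(** * Frobenius norm, operator norm and rank *)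

Definition normsq (R : pzRingType) (m n : nat) (A : 'M[R]_(m, n)) : R := \tr (A *m A^T).

Lemma normsqE (R : pzRingType) (m n : nat) (A : 'M[R]_(m, n)) :
  normsq A = \sum_i \sum_j A i j * A i j.
Proof.
rewrite /normsq /mxtrace; apply: eq_bigr => i _; rewrite mxE.
by apply: eq_bigr => j _; rewrite mxE.
Qed.

Lemma normsq_ge0 (R : realType) (m n : nat) (A : 'M[R]_(m, n)) : 0 <= normsq A.
Proof. by rewrite normsqE; apply: sumr_ge0 => i _; apply: sumr_ge0 => j _; rewrite -expr2 sqr_ge0. Qed.

Lemma normsq_eq0 (R : realType) (m n : nat) (A : 'M[R]_(m, n)) : (normsq A == 0) = (A == 0).
Proof.
apply/idP/eqP => [|->]; last by rewrite /normsq mul0mx mxtrace0.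
rewrite normsqE => /eqP A0; apply/matrixP => i j; rewrite mxE.
have ge0 (k : 'I_m) : true -> 0 <= \sum_l A k l * A k l.
  by move=> _; apply: sumr_ge0 => l _; rewrite -expr2 sqr_ge0.
have Ai0 := psumr_eq0P ge0 A0 (i := i) isT.
have ge0i (l : 'I_n) : true -> 0 <= A i l * A i l by rewrite -expr2 sqr_ge0.
by have /eqP := psumr_eq0P ge0i Ai0 (i := j) isT; rewrite mulf_eq0 orbb => /eqP.
Qed.

Lemma normsq_tr (R : comPzRingType) (m n : nat) (A : 'M[R]_(m, n)) : normsq A^T = normsq A.
Proof. by rewrite /normsq trmxK mxtrace_mulC. Qed.

Lemma normsqZ (R : comPzRingType) (m n : nat) (a : R) (A : 'M[R]_(m, n)) :
  normsq (a *: A) = a ^+ 2 * normsq A.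
Proof. by rewrite /normsq linearZ /= -scalemxAl -scalemxAr !mxtraceZ mulrA. Qed.

Lemma normsq_cV (R : comPzRingType) (m : nat) (u : 'cV[R]_m) : normsq u = (u^T *m u) 0 0.
Proof. by rewrite -normsq_tr /normsq trmxK /mxtrace big_ord1. Qed.

Lemma normsq_cVE (R : comPzRingType) (m : nat) (u : 'cV[R]_m) : normsq u = \sum_i u i 0 ^+ 2.
Proof. by rewrite normsqE; apply: eq_bigr => i _; rewrite big_ord1 expr2. Qed.

Lemma normsqD_orth (R : comPzRingType) (m n : nat) (A B : 'M[R]_(m, n)) :
  A *m B^T = 0 -> normsq (A + B) = normsq A + normsq B.
Proof.
move=> AB0; have BA0 : B *m A^T = 0 by rewrite -[LHS]trmxK trmx_mul trmxK AB0 trmx0.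
by rewrite /normsq linearD /= mulmxDl !mulmxDr AB0 BA0 addr0 add0r linearD.
Qed.

Lemma normsqD_le (R : realType) (m n : nat) (A B : 'M[R]_(m, n)) :
  normsq (A + B) <= 2 * normsq A + 2 * normsq B.
Proof.
rewrite !normsqE !mulr_sumr -big_split /=; apply: ler_sum => i _.
rewrite !mulr_sumr -big_split /=; apply: ler_sum => j _; rewrite !mxE.
by have := sqr_ge0 (A i j - B i j); nra.
Qed.

Lemma normsqN (R : pzRingType) (m n : nat) (A : 'M[R]_(m, n)) : normsq (- A) = normsq A.
Proof. by rewrite /normsq linearN /= mulmxN mulNmx opprK. Qed.

(** Here [a] bounds the square of the operator norm, which keeps square roots out of the linear
    algebra. *)
Definition op_le (R : realType) (m n : nat) (A : 'M[R]_(m, n)) (a : R) : Prop :=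
  forall u : 'cV[R]_n, normsq (A *m u) <= a * normsq u.

Lemma rV_sqr_scalar (R : comPzRingType) (n : nat) (q : 'rV[R]_n) : q *m q^T = (normsq q)%:M.
Proof. by rewrite [LHS]mx11_scalar /normsq /mxtrace big_ord1. Qed.

(* Each step splits off the component of the rows along the first row of [B]. *)
Lemma normsq_mulmx_op (R : realType) (a : R) (m r n : nat)
    (A : 'M[R]_(m, r)) (B : 'M[R]_(r, n)) :
  0 <= a -> op_le (A *m B) a -> normsq (A *m B) <= r%:R * a.
Proof.
move=> a0; elim: r A B => [|r IH] A B opD.
  by rewrite thinmx0 mul0mx /normsq mul0mx mxtrace0 mul0r.
rewrite -add1n in A B opD *.
set b := usubmx B.
have [D DAB] : {D | D = A *m B} by exists (A *m B).
rewrite -DAB in opD *.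
have [b0|b0] := eqVneq b 0.
  have DE : D = rsubmx A *m dsubmx B.
    by rewrite DAB -[A in LHS]hsubmxK -[B in LHS]vsubmxK mul_row_col -/b b0 mulmx0 add0r.
  rewrite DE; apply: (le_trans (IH _ _ _)); first by rewrite -DE.
  by rewrite ler_wpM2r // ler_nat.
have bn0 : normsq b != 0 by rewrite normsq_eq0.
have bp : 0 < normsq b by rewrite lt_neqAle eq_sym bn0 normsq_ge0.
(* [P] is the orthogonal projection onto the line of [b^T], where [D] contributes at most [a]. Since
   [b *m (1%:M - P) = 0], the other part of [D] factors through the remaining [r] rows, and it
   inherits the operator bound because [1%:M - P] is a contraction. *)
pose P : 'M[R]_n := (normsq b)^-1 *: (b^T *m b).
have PT : P^T = P by rewrite /P linearZ /= trmx_mul trmxK.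
have PP : P *m P = P.
  rewrite /P -scalemxAl -scalemxAr mulmxA -(mulmxA b^T) rV_sqr_scalar.
  by rewrite mul_mx_scalar -scalemxAl !scalerA; congr (_ *: _); field.
have DE : D = D *m P + D *m (1%:M - P) by rewrite -mulmxDr addrC subrK mulmx1.
rewrite DE normsqD_orth; last first.
  rewrite trmx_mul linearB /= PT trmx1 mulmxA -(mulmxA D) mulmxBr mulmx1 PP subrr.
  by rewrite mulmx0 mul0mx.
rewrite natrD mulrDl mul1r; apply: lerD.
  have -> : normsq (D *m P) = (normsq b)^-1 * normsq (D *m b^T).
    rewrite /normsq trmx_mul PT mulmxA -(mulmxA D) PP trmx_mul trmxK /P.
    by rewrite -scalemxAr -scalemxAl mxtraceZ !mulmxA.
  rewrite ler_pdivrMl // mulrC -[normsq b]normsq_tr; exact: opD.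
have DE' : D *m (1%:M - P) = rsubmx A *m (dsubmx B *m (1%:M - P)).
  rewrite DAB -[A in LHS]hsubmxK -[B in LHS]vsubmxK mul_row_col mulmxDl -/b -!mulmxA.
  rewrite [b *m _](_ : _ = 0) ?mulmx0 ?add0r //.
  rewrite mulmxBr mulmx1 /P -scalemxAr mulmxA rV_sqr_scalar mul_scalar_mx scalerA.
  by rewrite mulVf // scale1r subrr.
rewrite DE'; apply: IH => u; rewrite -DE' -mulmxA; apply: (le_trans (opD _)).
rewrite ler_wpM2l //.
have -> : normsq u = normsq (P *m u) + normsq ((1%:M - P) *m u).
  have uE : u = P *m u + (1%:M - P) *m u by rewrite -mulmxDl addrC subrK mul1mx.
  rewrite {1}uE -normsq_tr linearD /= normsqD_orth ?normsq_tr //.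
  rewrite trmxK trmx_mul PT -mulmxA [P *m _](_ : _ = 0) ?mulmx0 //.
  by rewrite mulmxA mulmxBr mulmx1 PP subrr mul0mx.
by rewrite lerDr normsq_ge0.
Qed.

Lemma normsq_rank_op (R : realType) (a : R) (m n : nat) (D : 'M[R]_(m, n)) :
  0 <= a -> op_le D a -> normsq D <= (\rank D)%:R * a.
Proof.
move=> a0; rewrite -{1 2}(mulmx_base D); exact: normsq_mulmx_op.
Qed.

Lemma op_leD (R : realType) (m n : nat) (A B : 'M[R]_(m, n)) (a b : R) :
  op_le A a -> op_le B b -> op_le (A + B) (2 * a + 2 * b).
Proof.
move=> opA opB u; rewrite mulmxDl; apply: (le_trans (normsqD_le _ _)).
by have := opA u; have := opB u; lra.
Qed.

Lemma op_leN (R : realType) (m n : nat) (A : 'M[R]_(m, n)) (a : R) :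
  op_le A a -> op_le (- A) a.
Proof. by move=> opA u; rewrite mulNmx normsqN. Qed.

Lemma cauchy_schwarz (R : realType) (n : nat) (u v : 'cV[R]_n) :
  (u^T *m v) 0 0 ^+ 2 <= normsq u * normsq v.
Proof.
have [u0|u0] := eqVneq u 0.
  by rewrite u0 trmx0 mul0mx mxE /normsq mul0mx mxtrace0 mul0r expr0n.
have up : 0 < normsq u by rewrite lt_neqAle eq_sym normsq_eq0 u0 normsq_ge0.
set a := normsq u; set b := (u^T *m v) 0 0.
have vu : (v^T *m u) 0 0 = b by rewrite /b -[v in RHS]trmxK -trmx_mul [RHS]mxE.
have := normsq_ge0 (a *: v - b *: u); rewrite normsq_cV.
have -> : (a *: v - b *: u)^T = a *: v^T - b *: u^T by rewrite linearB /= !linearZ.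
have eZ (x : 'M[R]_1) y : (y *: x) 0 0 = y * x 0 0 by rewrite mxE.
have eB (x y : 'M[R]_1) : (x - y) 0 0 = x 0 0 - y 0 0 by rewrite !mxE.
rewrite mulmxBl !mulmxBr -!scalemxAl -!scalemxAr !(eZ, eB) vu -/b -!normsq_cV -/a.
have -> : a * (a * normsq v) - a * (b * b) - (b * (a * b) - b * (b * a)) =
          a * (a * normsq v - b ^+ 2) by ring.
by rewrite pmulr_rge0 // subr_ge0.
Qed.

(** Write [|A u|^2] as the inner product of [u] with [A^T (A u)], apply Cauchy-Schwarz and the bound
    for [A^T], then cancel one factor [|A u|^2]. *)
Lemma op_le_tr (R : realType) (m n : nat) (A : 'M[R]_(m, n)) (a : R) :
  0 <= a -> op_le A^T a -> op_le A a.
Proof.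
move=> a0 opA u; have [->|Au] := eqVneq (normsq (A *m u)) 0.
  by rewrite mulr_ge0 ?normsq_ge0.
have Ap : 0 < normsq (A *m u) by rewrite lt_neqAle eq_sym Au normsq_ge0.
rewrite -(ler_pM2l Ap) -expr2 {1}normsq_cV trmx_mul -mulmxA.
apply: (le_trans (cauchy_schwarz _ _)); rewrite mulrC mulrCA mulrA.
by rewrite ler_wpM2r ?normsq_ge0.
Qed.

(** The columns of [B] form a basis of [U] and [S'] holds the coordinates. The inner dimension [n]
    is the form in which the low rank of the signal enters the estimates below. *)
Lemma columns_factor (R : fieldType) (p N n : nat) (U : {vspace 'cV[R]_p}) (S : 'M[R]_(p, N)) :
  \dim U = n -> (forall mu, col mu S \in U) ->
  exists (B : 'M[R]_(p, n)) (S' : 'M[R]_(n, N)), S = B *m S'.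
Proof.
move=> <- SU.
exists (\matrix_(i, j) (vbasis U)`_j i 0), (\matrix_(j, mu) coord (vbasis U) j (col mu S)).
apply/matrixP => i mu; have := coord_vbasis (SU mu) => /(congr1 (fun u : 'cV_p => u i 0)).
rewrite mxE => ->; rewrite summxE mxE; apply: eq_bigr => j _.
by rewrite !mxE mulrC.
Qed.

Lemma normsq_diag_mx_le (R : realType) (p : nat) (l : 'rV[R]_p) (a : R) (u : 'cV[R]_p) :
  (forall i, l 0 i ^+ 2 <= a) -> normsq (diag_mx l *m u) <= a * normsq u.
Proof.
move=> la; rewrite !normsq_cVE mulr_sumr; apply: ler_sum => i _.
by rewrite mul_diag_mx mxE exprMn ler_wpM2r ?sqr_ge0.
Qed.

Lemma normsq_orthogonal (R : realType) (p m : nat) (V : 'M[R]_p) (A : 'M[R]_(p, m)) :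
  V *m V^T = 1%:M -> normsq (V *m A) = normsq A.
Proof.
by move=> /mulmx1C VV; rewrite /normsq trmx_mul mulmxA mxtrace_mulC !mulmxA VV mul1mx.
Qed.

Lemma quadratic_form_diag (R : comPzRingType) (p : nat) (l : 'rV[R]_p) (u : 'cV[R]_p) :
  (u^T *m diag_mx l *m u) 0 0 = \sum_i l 0 i * u i 0 ^+ 2.
Proof.
rewrite -mulmxA mxE; apply: eq_bigr => i _.
by rewrite mul_diag_mx !mxE expr2 mulrCA.
Qed.

(* Dimension count: [n] linear conditions on the first [n + 1] coordinates. *)
Lemma kernel_first_coordinates (R : fieldType) (p n : nat) (G : 'M[R]_(n, p)) : (n < p)%N ->
  exists2 x : 'cV[R]_p, x != 0 & G *m x = 0 /\ forall i : 'I_p, (n < i)%N -> x i 0 = 0.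
Proof.
move=> np; pose E : 'M[R]_(n.+1, p) := pid_mx n.+1.
have : kermx (E *m G^T) != 0.
  apply/negP => /eqP k0; have := mxrank_ker (E *m G^T); rewrite k0 mxrank0 => /esym/eqP.
  by rewrite subn_eq0 => /leq_trans/(_ (rank_leq_col _)); rewrite ltnn.
case/rowV0Pn => y /sub_kermxP yE y0.
exists (y *m E)^T.
  apply: contra y0 => /eqP yE0; have Ef : row_free E.
    by rewrite /row_free rank_pid_mx.
  by apply/eqP/(row_free_inj Ef); rewrite mul0mx -[LHS]trmxK yE0 trmx0.
split; first by rewrite -[LHS]trmxK trmx_mul trmxK -mulmxA yE trmx0.
move=> i ni; rewrite !mxE big1 // => j _; rewrite mxE ltn_ord andbT.
case: eqP => [ji|]; last by rewrite mulr0.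
by have := ltn_ord j; rewrite ji ltnS leqNgt ni.
Qed.

(** * Deterministic bound on the truncation residual *)

Section TruncatedCovariance.
Variables (R : realType) (p N n : nat) (b : R).
Variables (B : 'M[R]_(p, n)) (S' : 'M[R]_(n, N)) (Z : 'M[R]_(p, N)) (Q C : 'M[R]_p).
Let Y := B *m S' + Z.
Hypotheses (b0 : 0 <= b) (opZ : op_le Z^T b) (QE : Q = sample_covariance Y).
Hypothesis trunc : spectral_truncation n Q C.

Lemma quadratic_form_covariance (v : 'cV[R]_p) :
  (v^T *m Q *m v) 0 0 = N%:R^-1 * normsq (Y^T *m v).
Proof.
by rewrite QE /sample_covariance -scalemxAr -scalemxAl mxE normsq_cV trmx_mul trmxK !mulmxA.
Qed.

Lemma truncation_residual_op : op_le (Q - C) ((b / N%:R) ^+ 2).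
Proof.
case: trunc => V [l [VV l_dec Ql Cl]] u.
have VV' := mulmx1C VV.
have N0 : 0 <= (N%:R : R)^-1 by rewrite invr_ge0.
have l_ge0 i : 0 <= l 0 i.
  pose v := V *m (delta_mx i 0 : 'cV_p).
  have := quadratic_form_covariance v; rewrite Ql /v trmx_mul.
  rewrite -!mulmxA (mulmxA V^T) VV' mul1mx (mulmxA V^T) VV' mul1mx mulmxA quadratic_form_diag.
  rewrite (bigD1 i) //= big1 ?addr0 => [|j ji].
    by rewrite mxE !eqxx expr1n mulr1 => ->; rewrite mulr_ge0 ?normsq_ge0.
  by rewrite mxE (negbTE ji) expr0n mulr0.
(* Indices start at 0, so [n <= i] singles out exactly the eigenvalues that the truncation drops.
   The test vector [x] lives on coordinates [j <= n], where [l 0 j] is at least [l 0 i], and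
   [V *m x] is orthogonal to the columns of [B], so [Y^T] acts on it as [Z^T]. *)
have l_le (i : 'I_p) : (n <= i)%N -> l 0 i <= b / N%:R.
  move=> ni; have np : (n < p)%N by apply: leq_ltn_trans ni (ltn_ord i).
  have [x x0 [Gx xi]] := kernel_first_coordinates (B^T *m V) np.
  have xp : 0 < normsq x by rewrite lt_neqAle eq_sym normsq_eq0 x0 normsq_ge0.
  have := quadratic_form_covariance (V *m x); rewrite {1}Ql trmx_mul.
  rewrite -!mulmxA (mulmxA V^T) VV' mul1mx (mulmxA V^T) VV' mul1mx mulmxA quadratic_form_diag.
  have -> : Y^T *m (V *m x) = Z^T *m (V *m x).
    rewrite /Y linearD /= mulmxDl trmx_mul -mulmxA (mulmxA B^T) Gx mulmx0 add0r //.
  move=> e.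
  have : l 0 i * normsq x <= N%:R^-1 * (b * normsq x).
    rewrite -(normsq_orthogonal x VV); apply: (@le_trans _ _ (N%:R^-1 * normsq (Z^T *m (V *m x)))); last first.
      exact: ler_wpM2l (opZ _).
    rewrite -e normsq_orthogonal // normsq_cVE mulr_sumr; apply: ler_sum => j _.
    have [jn|nj] := leqP j n; last by rewrite xi // expr0n !mulr0.
    by rewrite ler_wpM2r ?sqr_ge0 // l_dec // (leq_trans jn).
  by rewrite mulrCA mulrA ler_pM2r.
have -> : Q - C = V *m (diag_mx (\row_i (if (n <= i)%N then l 0 i else 0)) *m V^T).
  rewrite Ql Cl -mulmxBl -mulmxBr -mulmxA; congr (_ *m (_ *m _)).
  rewrite -linearB /=; congr diag_mx; apply/rowP => i; rewrite !mxE [(n <= i)%N]leqNgt.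
  by case: (_ < _)%N; rewrite /= ?subrr ?subr0.
rewrite -!mulmxA normsq_orthogonal //.
have -> : normsq u = normsq (V^T *m u) by rewrite normsq_orthogonal // trmxK.
apply: normsq_diag_mx_le => i; rewrite mxE; case: leqP => ni.
  by rewrite ler_sqr ?nnegrE ?l_ge0 ?l_le // mulr_ge0.
by rewrite expr0n /= sqr_ge0.
Qed.

Lemma noise_covariance_op : op_le (sample_covariance Z) ((b / N%:R) ^+ 2).
Proof.
have opZ' : op_le Z b by apply: op_le_tr.
move=> u; rewrite /sample_covariance -scalemxAl normsqZ -mulmxA.
have -> : (b / N%:R) ^+ 2 * normsq u = N%:R^-1 ^+ 2 * (b * (b * normsq u)).
  by rewrite exprMn; ring.
by rewrite ler_wpM2l ?sqr_ge0 // (le_trans (opZ' _)) // ler_wpM2l.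
Qed.

(** Without [Z Z^T], every term of [Y Y^T] carries [B] or [B^T]:
    [Y Y^T - Z Z^T = B S' Y^T + Z S'^T B^T]. With [C] this makes three matrices of rank at most
    [n]. *)
Lemma truncation_rank : (\rank (Q - C - sample_covariance Z)%R <= 3 * n)%N.
Proof.
have rC : (\rank C <= n)%N.
  case: trunc => V [l [_ _ _ ->]].
  have -> : diag_mx (\row_i (if (i < n)%N then l 0 i else 0)) = diag_mx l *m pid_mx n.
    apply/matrixP => i j; rewrite mul_diag_mx !mxE; case: eqP => [<-|] /=.
      by rewrite eqxx /=; case: ifP; rewrite ?mulr1 ?mulr0.
    by move=> /eqP/negbTE ij; rewrite [(i : nat) == j]ij mulr0.
  rewrite -mulmxA; apply: leq_trans (mxrankM_maxr _ _) _.
  apply: leq_trans (mxrankM_maxl _ _) _; apply: leq_trans (mxrankM_maxr _ _) _.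
  by have [np|/ltnW pn] := leqP n p; [rewrite rank_pid_mx | exact: leq_trans (rank_leq_row _) pn].
have -> : Q - C - sample_covariance Z =
    (B *m (N%:R^-1 *: (S' *m Y^T)) + (N%:R^-1 *: (Z *m S'^T)) *m B^T) - C.
  rewrite addrAC; congr (_ - C); rewrite QE /sample_covariance -scalerBr.
  rewrite -scalemxAr -scalemxAl -scalerDr; congr (_ *: _).
  rewrite {1}/Y mulmxDl -mulmxA -addrA; congr (_ + _).
  by rewrite /Y linearD /= mulmxDr addrK trmx_mul mulmxA.
have r1 : (\rank (B *m (N%:R^-1 *: (S' *m Y^T)))%R <= n)%N.
  exact: leq_trans (mxrankM_maxl _ _) (rank_leq_col _).
have r2 : (\rank ((N%:R^-1 *: (Z *m S'^T)) *m B^T)%R <= n)%N.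
  exact: leq_trans (mxrankM_maxr _ _) (rank_leq_row _).
apply: leq_trans (mxrank_add _ _) _; rewrite mxrank_opp.
have -> : (3 * n = n + n + n)%N by rewrite -addn1 mulnDl mul1n mul2n -addnn.
rewrite leq_add //; apply: leq_trans (mxrank_add _ _) _; exact: leq_add.
Qed.

(** The diagonal is bounded by the full Frobenius norm. The [12 n] is the rank [3 n] times the [4]
    lost in adding two operators of squared norm at most [a]. *)
Lemma residual_diag_bound :
  \sum_i ((Q - C) i i - sample_covariance Z i i) ^+ 2 <= (12 * n)%:R * (b / N%:R) ^+ 2.
Proof.
pose a := (b / N%:R) ^+ 2; pose D := Q - C - sample_covariance Z.
have opD : op_le D (2 * a + 2 * a).
  by apply: op_leD truncation_residual_op (op_leN noise_covariance_op).
have a0 : 0 <= a by rewrite sqr_ge0.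
have a40 : 0 <= 2 * a + 2 * a by lra.
apply: (@le_trans _ _ (normsq D)).
  rewrite normsqE; apply: ler_sum => i _; rewrite (bigD1 i) //= -expr2.
  have -> : D i i = (Q - C) i i - sample_covariance Z i i by rewrite /D !mxE.
  by rewrite lerDl sumr_ge0 // => j _; rewrite -expr2 sqr_ge0.
apply: (le_trans (normsq_rank_op a40 opD)).
rewrite (_ : 2 * a + 2 * a = 4 * a); last by ring.
rewrite mulrA -natrM ler_wpM2r // ler_nat.
have -> : (12 * n = 3 * n * 4)%N by rewrite mulnAC.
by rewrite leq_mul2r truncation_rank orbT.
Qed.
End TruncatedCovariance.

(** * Comparison in the Potts functional *)

Lemma jumps_le (R : realType) (p : nat) (tau : 'rV[R]_p) : (jumps tau <= p)%N.
Proof.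
rewrite /jumps -[X in (_ <= X)%N]card_ord -(card_in_imset (f := fst)) ?max_card //.
move=> [i j] [i' j']; rewrite !inE /= => /andP[/eqP jE _] /andP[/eqP jE' _] ii'.
by subst i'; congr pair; apply/val_inj; rewrite /= jE jE'.
Qed.

Lemma sqdist_triangle (R : realType) (p : nat) (u v w : 'rV[R]_p) :
  sqdist u w <= 2 * sqdist v u + 2 * sqdist v w.
Proof.
rewrite /sqdist !mulr_sumr -big_split /=; apply: ler_sum => i _.
by have := sqr_ge0 ((u 0 i - v 0 i) - (v 0 i - w 0 i)); nra.
Qed.

Lemma potts_argmin_sqdist (R : realType) (p : nat) (beta : R) (u tau s : 'rV[R]_p) :
  0 <= beta -> potts_argmin beta u tau ->
  sqdist tau s <= 4 * sqdist u s + 2 * beta * p%:R.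
Proof.
move=> b0 /(_ s); rewrite /potts => le.
have j1 : beta * (jumps s)%:R <= beta * p%:R by rewrite ler_wpM2l // ler_nat jumps_le.
have j2 : 0 <= beta * (jumps tau)%:R by rewrite mulr_ge0.
by have := sqdist_triangle tau u s; lra.
Qed.

(** * A grid net for bilinear forms *)

Definition bilin (R : realType) (p N : nat) (X : 'M[R]_(p, N)) (u : 'cV[R]_p) (v : 'cV[R]_N) : R :=
  \sum_i \sum_j u i 0 * X i j * v j 0.

Lemma bilinE (R : realType) (p N : nat) (X : 'M[R]_(p, N)) u v :
  bilin X u v = (u^T *m X *m v) 0 0.
Proof.
rewrite -mulmxA mxE; apply: eq_bigr => i _; rewrite !mxE mulr_sumr.
by apply: eq_bigr => j _; rewrite mulrA.
Qed.

Lemma bilinDl (R : realType) (p N : nat) (X : 'M[R]_(p, N)) u u' v :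
  bilin X (u + u') v = bilin X u v + bilin X u' v.
Proof. by rewrite !bilinE linearD /= !mulmxDl mxE. Qed.

Lemma bilinDr (R : realType) (p N : nat) (X : 'M[R]_(p, N)) u v v' :
  bilin X u (v + v') = bilin X u v + bilin X u v'.
Proof. by rewrite !bilinE mulmxDr mxE. Qed.

Lemma bilinZl (R : realType) (p N : nat) (X : 'M[R]_(p, N)) a u v :
  bilin X (a *: u) v = a * bilin X u v.
Proof. by rewrite !bilinE linearZ /= -!scalemxAl mxE. Qed.

Lemma bilinZr (R : realType) (p N : nat) (X : 'M[R]_(p, N)) a u v :
  bilin X u (a *: v) = a * bilin X u v.
Proof. by rewrite !bilinE -!scalemxAr mxE. Qed.

(** Since [k <= k ^ 2] for natural numbers, the integer points of the nonnegative orthant with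
    squared norm at most [L] all have coordinate sum at most [L]. The larger set is used because it
    has an exact count. *)
Definition grid (m L : nat) : {set m.-tuple 'I_L.+1} :=
  [set t : m.-tuple 'I_L.+1 | (\sum_(i <- t) i <= L)%N]%SET.

(** The count is the binomial coefficient of [m + L] over [m], one term in the expansion of
    [(1 + 1) ^ (m + L)]. *)
Lemma card_grid (m L : nat) : (#|grid m L| <= 2 ^ (m + L))%N.
Proof.
have -> : (2 ^ (m + L) = (1 + 1) ^ (m + L))%N by [].
rewrite card_partial_ord_partitions expnDn (bigD1 (@inord (m + L) m)) //=.
by rewrite !exp1n !muln1 inordK ?leq_addr // ltnS leq_addr.
Qed.

Definition grid_vector (R : realType) (h : R) (m L : nat) (t : m.-tuple 'I_L.+1) : 'cV[R]_m :=
  \col_i ((tnth t i)%:R / h).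

(** Restricting to nonnegative coordinates allows rounding down to natural numbers; a general vector
    is a difference of two such vectors. *)
Definition nonneg_ball (R : realType) (m : nat) (u : 'cV[R]_m) : Prop :=
  (forall i, 0 <= u i 0) /\ normsq u <= 1.

Lemma nonneg_ball_le1 (R : realType) (m : nat) (u : 'cV[R]_m) :
  nonneg_ball u -> forall i, u i 0 <= 1.
Proof.
move=> [u0 u1] i; rewrite -(@ler_sqr _ (u i 0)) ?nnegrE ?u0 // expr1n.
apply: le_trans u1; rewrite normsq_cVE (bigD1 i) //= lerDl.
by apply: sumr_ge0 => j _; rewrite sqr_ge0.
Qed.

(* Rounding down to the grid keeps the error vector in the nonnegative orthant. *)
Lemma grid_approx (R : realType) (m M : nat) (h : R) (u : 'cV[R]_m) :
  (0 < M)%N -> (m <= M)%N -> 0 < h -> h ^+ 2 = (16 * M)%:R -> nonneg_ball u ->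
  exists2 t, t \in grid m (16 * M) &
    nonneg_ball (grid_vector h t) /\ nonneg_ball (4 *: (u - grid_vector h t)).
Proof.
move=> M0 mM h0 hM [u0 u1]; pose a i := Num.truncn (h * u i 0).
have hu0 i : 0 <= h * u i 0 by rewrite mulr_ge0 // ltW.
have a_le i : (a i)%:R <= h * u i 0 by rewrite truncn_le.
have a_gt i : h * u i 0 < (a i)%:R + 1 by rewrite natr1 truncnS_gt.
(* By [k <= k ^ 2] the sum of the [a i] is at most [h ^ 2 * normsq u], which is at most [16 * M]. *)
have sum_a : (\sum_i a i <= 16 * M)%N.
  rewrite -(ler_nat R) -hM -[leRHS]mulr1; apply: (@le_trans _ _ (h ^+ 2 * normsq u)).
    rewrite normsq_cVE mulr_sumr natr_sum; apply: ler_sum => i _.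
    rewrite -exprMn; apply: (@le_trans _ _ ((a i)%:R ^+ 2)).
      by rewrite -natrX ler_nat; case: (a i) => // k; rewrite expnS leq_pmulr ?expn_gt0.
    by rewrite ler_sqr ?nnegrE.
  by rewrite ler_wpM2l ?sqr_ge0.
have a_lt i : (a i < (16 * M).+1)%N.
  by rewrite ltnS (leq_trans _ sum_a) // (bigD1 i) //= leq_addr.
pose t : m.-tuple 'I_(16 * M).+1 := [tuple Ordinal (a_lt i) | i < m].
have tE i : grid_vector h t i 0 = (a i)%:R / h by rewrite mxE tnth_mktuple.
have t_le i : grid_vector h t i 0 <= u i 0 by rewrite tE ler_pdivrMr // mulrC.
have t_ge i : 0 <= grid_vector h t i 0 by rewrite tE divr_ge0 // ltW.
have dE i : (u - grid_vector h t) i 0 = u i 0 - grid_vector h t i 0.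
  by rewrite [LHS]mxE [X in _ + X]mxE.
exists t.
  by rewrite inE big_tuple (eq_bigr a) // => i _; rewrite tnth_mktuple.
split; split => //.
- apply: le_trans u1; rewrite !normsq_cVE; apply: ler_sum => i _.
  by rewrite ler_sqr ?nnegrE.
- by move=> i; rewrite mxE mulr_ge0 // dE subr_ge0.
(* Each coordinate of the error is at most [1 / h], so its squared norm is at most
   [m / (16 * M) <= 1 / 16]; this is why it can be scaled by [4]. *)
- rewrite normsqZ normsq_cVE -[leRHS](@mulfV _ (16%:R * M%:R : R)); last first.
    by rewrite mulf_neq0 // pnatr_eq0 // -lt0n.
  rewrite -[leRHS]mulrA (_ : 4 ^+ 2 = 16%:R :> R); last by rewrite -natrX.
  rewrite ler_wpM2l //; apply: (@le_trans _ _ (\sum_(i < m) (16%:R * M%:R : R)^-1)).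
    apply: ler_sum => i _; rewrite -natrM -hM.
    have -> : (u - grid_vector h t) i 0 = (h * u i 0 - (a i)%:R) / h.
      by rewrite dE tE; field; rewrite gt_eqF.
    rewrite expr_div_n ler_piMl ?invr_ge0 ?sqr_ge0 //.
    by rewrite expr_le1 // ?subr_ge0 // lerBlDr addrC ltW.
  rewrite sumr_const card_ord -[_ *+ m]mulr_natl ler_wpM2r ?invr_ge0 ?mulr_ge0 //.
  by rewrite ler_nat.
Qed.

Section Net.
Variables (R : realType) (p N M : nat) (h s : R) (X : 'M[R]_(p, N)).
Hypotheses (M0 : (0 < M)%N) (pM : (p <= M)%N) (NM : (N <= M)%N).
Hypotheses (h0 : 0 < h) (hM : h ^+ 2 = (16 * M)%:R).
Hypothesis net : forall a b, a \in grid p (16 * M) -> b \in grid N (16 * M) ->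
  normsq (grid_vector h a) <= 1 -> normsq (grid_vector h b) <= 1 -> `|bilin X (grid_vector h a) (grid_vector h b)| <= s.

Lemma bilin_ball_le u v : nonneg_ball u -> nonneg_ball v -> `|bilin X u v| <= 2 * s.
Proof.
pose A := [set r | exists u v, [/\ nonneg_ball u, nonneg_ball v & r = `|bilin X u v|]].
(* A crude entrywise bound suffices: finiteness of the supremum is what allows half of it to be
   absorbed below. *)
have ubA : has_ubound A.
  exists (\sum_i \sum_j `|X i j|) => _ [u' [v' [u1 v1 ->]]].
  apply: (le_trans (ler_norm_sum _ _ _)); apply: ler_sum => i _.
  apply: (le_trans (ler_norm_sum _ _ _)); apply: ler_sum => j _.
  rewrite !normrM (ger0_norm (u1.1 i)) (ger0_norm (v1.1 j)).
  rewrite -[leRHS]mul1r -[leRHS]mulr1 ler_pM ?mulr_ge0 ?u1.1 ?v1.1 //.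
    by rewrite ler_pM ?u1.1 // nonneg_ball_le1.
  exact: nonneg_ball_le1.
have A_le u' v' : nonneg_ball u' -> nonneg_ball v' -> `|bilin X u' v'| <= sup A.
  by move=> u1 v1; apply: (ub_le_sup ubA); exists u', v'.
suff supA : sup A <= 2 * s by move=> u1 v1; apply: le_trans supA; exact: A_le.
(* Each of the two rounding errors costs at most a quarter of the supremum. *)
suff : sup A <= s + sup A / 2 by lra.
have ball0 (m : nat) : nonneg_ball (0 : 'cV[R]_m).
  by split; [move=> i; rewrite mxE | rewrite /normsq mul0mx mxtrace0].
apply: ge_sup; first by exists `|bilin X 0 0|, 0, 0; split.
move=> _ [u' [v' [u1 v1 ->]]].
have [a ga [a1 ua1]] := grid_approx M0 pM h0 hM u1.
have [b gb [b1 vb1]] := grid_approx M0 NM h0 hM v1.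
set a' := grid_vector h a in a1 ua1 *; set b' := grid_vector h b in b1 vb1 *.
have -> : bilin X u' v' = bilin X a' b' + bilin X (4 *: (u' - a')) v' / 4
    + bilin X a' (4 *: (v' - b')) / 4.
  rewrite -{1}(addrNK a' u') addrC bilinDl -{1}(addrNK b' v') [X in bilin _ a' X]addrC bilinDr.
  by rewrite bilinZl bilinZr; field.
have := net ga gb a1.2 b1.2; have := A_le _ _ ua1 v1; have := A_le _ _ a1 vb1.
move=> H1 H2 H3; apply: (le_trans (ler_normD _ _)).
have n4 (x : R) : `|x / 4| = `|x| / 4 by rewrite normrM [X in _ * X]ger0_norm.
apply: (@le_trans _ _ (`|bilin X a' b'| + `|bilin X (4 *: (u' - a')) v' / 4| +
  `|bilin X a' (4 *: (v' - b')) / 4|)); first by rewrite lerD2r ler_normD.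
by rewrite !n4; lra.
Qed.

Let pos_part (m : nat) (u : 'cV[R]_m) : 'cV[R]_m := \col_i Num.max (u i 0) 0.

Let pos_part_ball m (u : 'cV[R]_m) : normsq u <= 1 -> nonneg_ball (pos_part u).
Proof.
move=> u1; split=> [i|]; first by rewrite mxE le_max lexx orbT.
apply: le_trans u1; rewrite !normsq_cVE; apply: ler_sum => i _; rewrite mxE.
by case: (leP (u i 0) 0) => _; rewrite ?expr0n /= ?sqr_ge0.
Qed.

Let pos_partE m (u : 'cV[R]_m) : u = pos_part u + (-1) *: pos_part (- u).
Proof.
apply/colP => i; rewrite !mxE; case: (leP (u i 0) 0) => u0.
  by rewrite max_l ?oppr_ge0 //; ring.
by rewrite max_r ?mulr0 ?addr0 // oppr_le0 ltW.
Qed.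

Lemma bilin_unit_le u v : normsq u <= 1 -> normsq v <= 1 -> `|bilin X u v| <= 8 * s.
Proof.
move=> u1 v1; rewrite [u]pos_partE [v]pos_partE !bilinDl !bilinDr !bilinZl !bilinZr.
have u1' : normsq (- u) <= 1 by rewrite normsqN.
have v1' : normsq (- v) <= 1 by rewrite normsqN.
move: (pos_part_ball u1) (pos_part_ball u1') (pos_part_ball v1) (pos_part_ball v1').
move=> U U' V V'.
have := bilin_ball_le U V; have := bilin_ball_le U V'.
have := bilin_ball_le U' V; have := bilin_ball_le U' V'.
rewrite !ler_norml => /andP[? ?] /andP[? ?] /andP[? ?] /andP[? ?].
by apply/andP; split; lra.
Qed.

(** Duality: with [v = X^T u], [|v|^2] is the form at [(u, v)], hence at most [8 s |u| |v|]. The [8]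
    is four sign combinations of positive and negative parts, each costing [2 * s]. *)
Lemma op_le_net : op_le X^T (64 * s ^+ 2).
Proof.
move=> u; set v := X^T *m u.
have [v0|v0] := eqVneq v 0.
  by rewrite v0 {1}/normsq mul0mx mxtrace0 mulr_ge0 ?normsq_ge0 // mulr_ge0 // sqr_ge0.
have u0 : u != 0 by apply: contra v0 => /eqP u0; rewrite /v u0 mulmx0.
have norm_gt0 m (x : 'cV[R]_m) : x != 0 -> 0 < normsq x.
  by move=> x0; rewrite lt_neqAle eq_sym normsq_eq0 x0 normsq_ge0.
have unit m (x : 'cV[R]_m) : x != 0 -> normsq ((Num.sqrt (normsq x))^-1 *: x) <= 1.
  move=> /norm_gt0 x0; rewrite normsqZ exprVn sqr_sqrtr ?(ltW x0) //.
  by rewrite mulVf ?gt_eqF.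
have := bilin_unit_le (unit _ _ u0) (unit _ _ v0).
have -> : bilin X ((Num.sqrt (normsq u))^-1 *: u) ((Num.sqrt (normsq v))^-1 *: v) =
    normsq v / (Num.sqrt (normsq u) * Num.sqrt (normsq v)).
  rewrite bilinZl bilinZr bilinE -[u^T *m X]trmxK trmx_mul trmxK -/v -normsq_cV.
  by rewrite invfM; ring.
have vp := norm_gt0 _ _ v0; have up := norm_gt0 _ _ u0.
have sp : 0 < Num.sqrt (normsq u) * Num.sqrt (normsq v) by rewrite mulr_gt0 ?sqrtr_gt0.
rewrite ger0_norm ?divr_ge0 ?normsq_ge0 ?(ltW sp) // ler_pdivrMr // => le.
rewrite -(ler_pM2r vp) -expr2.
have -> : 64 * s ^+ 2 * normsq u * normsq v =
    (8 * s * (Num.sqrt (normsq u) * Num.sqrt (normsq v))) ^+ 2.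
  by rewrite !exprMn !sqr_sqrtr ?normsq_ge0 //; ring.
by rewrite ler_sqr // nnegrE ?normsq_ge0 // (le_trans _ le) ?normsq_ge0.
Qed.
End Net.

(** * Expectation of a product of independent variables *)

Section IntegralIndependent.
Context (R : realType) (d : measure_display) (T : measurableType d) (P : probability T R).

Section TwoVariables.
Import HBNNSimple finmap.
Variables (g x : T -> R) (c : R).
Hypotheses (mg : measurable_fun setT g) (g0 : forall w, 0 <= g w).
Hypothesis mx : measurable_fun setT x.
Hypothesis indep : forall B, measurable B ->
  (\int[P]_w (g w * \1_B (x w))%:E = c%:E * P (x @^-1` B))%E.

Let s (h : {nnsfun R >-> R}) : seq R := finmap.enum_fset (fset_set (range h)).

(** In the premise [indep] the constant [c] is the mean of [g] (take [B] the whole line). Testing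
    against indicators of [x] alone leaves [g] free to be a product of other variables. *)
Lemma integral_mul_nnsfun_comp (h : {nnsfun R >-> R}) :
  (\int[P]_w (g w * h (x w))%:E =
   c%:E * \sum_(i < size (s h)) ((s h)`_i)%:E * P (x @^-1` (h @^-1` [set (s h)`_i])))%E.
Proof.
have ms i : measurable (h @^-1` [set (s h)`_i]) by exact: measurable_sfunP.
have s0 (i : 'I_(size (s h))) : 0 <= (s h)`_i.
  have : (s h)`_i \in fset_set (range h) by apply: mem_nth.
  by rewrite in_fset_set // => /set_mem[y _ <-].
under eq_integral => w _.
  rewrite fimfunEord mulr_sumr -sumEFin.
  under eq_bigr => i _ do rewrite mulrCA EFinM.
  over.
have m1 i : measurable_fun setT (fun w => (g w * \1_(h @^-1` [set (s h)`_i]) (x w))%:E).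
  apply/measurable_EFinP; apply: measurable_funM => //.
  by apply: measurableT_comp => //; exact: measurable_indic.
have p1 i w : (0 <= (g w * \1_(h @^-1` [set (s h)`_i]) (x w))%:E)%E.
  by rewrite lee_fin mulr_ge0.
rewrite ge0_integral_sum //=; last 2 first.
- move=> i; apply: measurable_funeM. exact: (m1 i).
- by move=> i w _; apply: mule_ge0; [rewrite lee_fin; exact: (s0 i) | exact: (p1 i)].
rewrite ge0_sume_distrr; last first.
  by move=> i _; apply: mule_ge0; [rewrite lee_fin; exact: (s0 i) | exact: measure_ge0].
apply: eq_bigr => i _; rewrite ge0_integralZl_EFin //.
by rewrite indep // muleCA.
Qed.

Lemma cvg_integral_mul_nnsfun_approx (f : R -> R) (mf : measurable_fun setT (EFin \o f)) :
  (forall y, 0 <= f y) ->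
  (\int[P]_w (g w * nnsfun_approx measurableT mf n (x w))%:E @[n --> \oo] -->
   \int[P]_w (g w * f (x w))%:E)%E.
Proof.
move=> f0; pose h := nnsfun_approx measurableT mf.
have mh n : measurable_fun setT (fun w => (g w * h n (x w))%:E).
  apply/measurable_EFinP; apply: measurable_funM => //; exact: measurableT_comp.
have h0 n w : setT w -> (0 <= (g w * h n (x w))%:E)%E.
  by move=> _; rewrite lee_fin mulr_ge0.
have nd w : setT w -> {homo (fun n => (g w * h n (x w))%:E) : a b / (a <= b)%N >-> (a <= b)%E}.
  move=> _ a b ab; rewrite lee_fin ler_wpM2l //.
  by have /lefP := nd_nnsfun_approx measurableT mf ab; apply.
have := cvg_monotone_convergence (mu := P) measurableT mh h0 nd.
congr (_ --> _); apply: eq_integral => w _.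
apply/cvg_lim => //.
have -> : (fun n => (g w * h n (x w))%:E) = (fun n => (g w)%:E * (h n (x w))%:E)%E by [].
rewrite EFinM; apply: cvgeZl => //.
by apply: (@cvg_nnsfun_approx _ _ _ _ measurableT _ mf) => // y _; rewrite lee_fin.
Qed.
End TwoVariables.

Import HBNNSimple.
(** The formula for simple functions is used for [g] and for the constant [1]. The approximating
    integrals differ by the factor [c], so their monotone limits do too. *)
Lemma integral_mul_comp (g x : T -> R) (c e : R) (f : R -> R) :
  measurable_fun setT g -> (forall w, 0 <= g w) -> measurable_fun setT x ->
  (forall B, measurable B -> (\int[P]_w (g w * \1_B (x w))%:E = c%:E * P (x @^-1` B))%E) ->
  measurable_fun setT f -> (forall y, 0 <= f y) -> (\int[P]_w (f (x w))%:E = e%:E)%E ->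
  (\int[P]_w (g w * f (x w))%:E = (c * e)%:E)%E.
Proof.
move=> mg g0 mx indep mf f0 fe.
have mf' : measurable_fun setT (EFin \o f) by exact/measurable_EFinP.
have L1 := cvg_integral_mul_nnsfun_approx mg g0 mx mf' f0.
have m1 : measurable_fun [set: T] (fun=> 1 : R) by [].
have L2 := cvg_integral_mul_nnsfun_approx (g := fun=> 1) m1 (fun=> ler01) mx mf' f0.
have indep1 B : measurable B -> (\int[P]_w (1 * \1_B (x w))%:E = 1%:E * P (x @^-1` B))%E.
  move=> mB; have mxB : measurable (x @^-1` B) by rewrite -[X in measurable X]setTI; exact: mx.
  rewrite mul1e -[in RHS](setIT (x @^-1` B)) -integral_indic //.
  by apply: eq_integral => w _; rewrite mul1r.
have e1 : (\int[P]_w (1 * f (x w))%:E = e%:E)%E.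
  by rewrite -fe; apply: eq_integral => w _; rewrite mul1r.
rewrite e1 in L2.
have : (\int[P]_w (g w * nnsfun_approx measurableT mf' n (x w))%:E @[n --> \oo] -->
    c%:E * e%:E)%E.
  have -> : (fun n => \int[P]_w (g w * nnsfun_approx measurableT mf' n (x w))%:E)%E =
      (fun n => c%:E * \int[P]_w (1 * nnsfun_approx measurableT mf' n (x w))%:E)%E.
    apply/funext => n; rewrite (integral_mul_nnsfun_comp mg g0 mx indep).
    by rewrite (integral_mul_nnsfun_comp (g := fun=> 1) m1 (fun=> ler01) mx indep1) mul1e.
  by apply: cvgeZl.
by move=> L; rewrite -(cvg_lim _ L1) // EFinM; exact: cvg_lim.
Qed.

Lemma integral_prod_independent (I : finType) (X : I -> T -> R) (h : I -> R -> R) (e : I -> R) :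
  (forall i, measurable_fun setT (X i)) -> mutually_independent P X ->
  (forall i, measurable_fun setT (h i)) -> (forall i y, 0 <= h i y) ->
  (forall i, (\int[P]_w (h i (X i w))%:E = (e i)%:E)%E) ->
  (\int[P]_w (\prod_i h i (X i w))%:E = (\prod_i e i)%:E)%E.
Proof.
move=> mX indep.
(* Induction on the number of factors that are not indicators. *)
pose ind (f : R -> R) := exists2 B, measurable B & f = \1_B.
suff H k : forall (S : {set I}) h e, #|S| = k ->
  (forall i, i \notin S -> ind (h i)) ->
  (forall i, measurable_fun setT (h i)) -> (forall i y, 0 <= h i y) ->
  (forall i, (\int[P]_w (h i (X i w))%:E = (e i)%:E)%E) ->
  (\int[P]_w (\prod_i h i (X i w))%:E = (\prod_i e i)%:E)%E.
  by apply: (H _ [set: I]%SET) => // i; rewrite inE.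
have mXB i B : measurable B -> measurable (X i @^-1` B).
  by move=> mB; rewrite -[X in measurable X]setTI; exact: mX.
have PE A : measurable A -> P A = (fine (P A))%:E by move=> mA; rewrite fineK // fin_num_measure.
have indE i B : measurable B -> (\int[P]_w (\1_B (X i w))%:E = P (X i @^-1` B))%E.
  move=> mB; rewrite -[in RHS](setIT (X i @^-1` B)) -integral_indic //; exact: mXB.
elim: k => [|k IH] S {}h {}e Sk hS mh h0 he.
  have /choice[B BE] : forall i, exists B, measurable B /\ h i = \1_B.
    by move=> i; have [|B mB ->] := hS i; [rewrite (cards0_eq Sk) inE | exists B].
  have mB i := (BE i).1.
  have eP i : P (X i @^-1` B i) = (e i)%:E.
    rewrite -he -indE //; apply: eq_integral => w _; by rewrite (BE i).2.
  have mBX : measurable [set w | forall i, i \in [set: I]%SET -> B i (X i w)].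
    have -> : [set w | forall i, i \in [set: I]%SET -> B i (X i w)] =
        \big[setI/setT]_(i : I) (X i @^-1` B i).
      apply/seteqP; split => [w H|w]; rewrite -bigcap_seq /=.
        by move=> i _; apply: H; rewrite inE.
      by move=> H i _; apply: H => /=; rewrite mem_index_enum.
    by apply: bigsetI_measurable => i _; exact: mXB.
  rewrite -[RHS](_ : (\prod_(i in [set: I]%SET) P (X i @^-1` B i))%E = _); last first.
    rewrite -prodEFin; apply: eq_big => i; first by rewrite inE.
    by rewrite eP.
  rewrite -indep // -[in RHS](setIT [set _ | _]) -integral_indic //.
  apply: eq_integral => w _; congr EFin; rewrite indicE.
  have [H|H] := pselect (forall i, i \in [set: I]%SET -> B i (X i w)).
    rewrite mem_set // big1 // => i _.
    by rewrite (BE i).2 indicE mem_set //; apply: H; rewrite inE.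
  rewrite memNset //; have /existsNP[i /not_implyP[_ nB]] := H.
  by rewrite (bigD1 i) //= (BE i).2 indicE memNset // mul0r.
have /card_gt0P[i0 i0S] : (0 < #|S|)%N by rewrite Sk.
have hi0 A w : measurable A -> \prod_i (if i == i0 then \1_A else h i) (X i w) =
    (\prod_(i | i != i0) h i (X i w)) * \1_A (X i0 w).
  move=> mA; rewrite (bigD1 i0) //= eqxx mulrC; congr (_ * _).
  by apply: eq_bigr => i /negbTE ->.
rewrite (bigD1 i0) //= mulrC.
under eq_integral => w _ do rewrite (bigD1 i0) //= mulrC.
(* The premise against an arbitrary indicator is the induction hypothesis: putting [\1_A] in place
   of [h i0] removes [i0] from the general factors. *)
apply: integral_mul_comp => //.
- under eq_fun do rewrite -big_filter.
  by apply: measurable_prod => i _; exact: measurableT_comp.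
- by move=> w; apply: prodr_ge0.
move=> A mA; under eq_integral => w _ do rewrite -hi0 //.
rewrite (PE (X i0 @^-1` A)); last exact: mXB.
rewrite -EFinM.
rewrite (IH (S :\ i0)%SET (fun i => if i == i0 then \1_A else h i) (fun i => if i == i0 then fine (P (X i0 @^-1` A)) else e i)).
- rewrite (bigD1 i0) //= eqxx mulrC; congr (_ * _)%:E.
  by apply: eq_bigr => i /negbTE ->.
- by move: Sk; rewrite (cardsD1 i0) i0S add1n => -[].
- move=> i; rewrite !inE negb_and negbK => /orP[/eqP ->|iS].
    by rewrite eqxx; exists A.
  by case: eqP => _; [exists A | exact: hS].
- by move=> i; case: eqP => // _; exact: measurable_indic.
- by move=> i y; case: eqP => // _.
- by move=> i; case: eqP => [->|//]; rewrite indE // PE //; exact: mXB.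
Qed.
End IntegralIndependent.

(** * Exponential moments and Chernoff's bound *)

Lemma expR_le_quadratic (R : realType) (y : R) : expR y <= 1 + y + y ^+ 2 * expR `|y|.
Proof.
(* [e^y - 1 <= y e^y] twice. *)
have expB (z : R) : expR z - 1 <= z * expR z.
  have : 1 - z <= expR (- z) by have := expR_ge1Dx (- z).
  rewrite expRN -(ler_pM2r (expR_gt0 z)) mulVf ?gt_eqF ?expR_gt0 //; lra.
suff : y * (expR y - 1) <= y ^+ 2 * expR `|y| by have := expB y; lra.
have [y0|y0] := leP 0 y.
  by rewrite ger0_norm // expr2 -mulrA ler_wpM2l.
have e1 : 1 <= expR `|y| by rewrite -expR0 ler_expR.
apply: (@le_trans _ _ (y ^+ 2)); last by rewrite ler_peMr ?sqr_ge0.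
rewrite -subr_ge0 (_ : _ - _ = (- y) * (expR y - 1 - y)); last by ring.
by rewrite mulr_ge0 ?oppr_ge0 ?(ltW y0) //; have := expR_ge1Dx y; lra.
Qed.

Lemma expR_ge_id (R : realType) (z : R) : z <= expR z.
Proof. by have := expR_ge1Dx z; lra. Qed.

Section Moments.
Context (R : realType) (d : measure_display) (T : measurableType d) (P : probability T R).

(** Markov's inequality for the product of exponentials; the tilting parameter is absorbed into
    [f]. *)
Lemma chernoff (I : finType) (X : I -> T -> R) (f : I -> R -> R) (b : I -> R) (a : R) :
  (forall i, measurable_fun setT (X i)) -> mutually_independent P X ->
  (forall i, measurable_fun setT (f i)) ->
  (forall i, (\int[P]_w (expR (f i (X i w)))%:E <= (expR (b i))%:E)%E) ->
  (P [set w | (a <= \sum_i f i (X i w))%R] <= (expR (\sum_i b i - a))%:E)%E.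
Proof.
move=> mX indep mf fb.
have e_fin i : (\int[P]_w (expR (f i (X i w)))%:E)%E \is a fin_num.
  rewrite ge0_fin_numE; first by apply: le_lt_trans (fb i) _; exact: ltry.
  by apply: integral_ge0 => w _; rewrite lee_fin expR_ge0.
have prodE := @integral_prod_independent _ _ _ P I X (fun i y => expR (f i y))
  (fun i => fine (\int[P]_w (expR (f i (X i w)))%:E)%E) mX indep
  (fun i => measurableT_comp (@measurable_expR R) (mf i))
  (fun i y => expR_ge0 _) (fun i => esym (fineK (e_fin i))).
have mS : measurable_fun setT (fun w => \sum_i f i (X i w)).
  by apply: measurable_sum => i; exact: measurableT_comp.
set A := [set w | _].
have mA : measurable A.
  have -> : A = (fun w => \sum_i f i (X i w)) @^-1` `[a, +oo[%classic.
    by apply/seteqP; split=> w; rewrite /A /= in_itv /= andbT.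
  by rewrite -[X in measurable X]setTI; apply: mS.
have : ((expR a)%:E * P A <= (expR (\sum_i b i))%:E)%E.
  apply: (@le_trans _ _ (\int[P]_w (\prod_i expR (f i (X i w)))%:E)%E).
    rewrite -[in leLHS](setIT A) -integral_indic // -ge0_integralZl_EFin //; last first.
      by apply/measurable_EFinP; exact: measurable_indic.
    apply: ge0_le_integral => //.
    - by apply: measurable_funeM; apply/measurable_EFinP; exact: measurable_indic.
    - apply/measurable_EFinP; under eq_fun do rewrite -expR_sum.
      exact: measurableT_comp.
    move=> w _; rewrite -EFinM lee_fin -expR_sum indicE.
    have [wA|wA] := boolP (w \in A); last by rewrite mulr0 expR_ge0.
    by rewrite mulr1 ler_expR; exact: (set_mem wA).
  rewrite prodE lee_fin expR_sum; apply: ler_prod => i _.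
  rewrite fine_ge0 /=; last by apply: integral_ge0 => w _; rewrite lee_fin expR_ge0.
  by rewrite -lee_fin fineK.
have -> : P A = (fine (P A))%:E by rewrite fineK // fin_num_measure.
rewrite -EFinM !lee_fin expRB => H.
by rewrite ler_pdivlMr ?expR_gt0 // mulrC.
Qed.

Lemma integrable_dominated (f h : T -> R) (c : R) :
  measurable_fun setT f -> measurable_fun setT h -> (\int[P]_w (h w)%:E < +oo)%E ->
  (forall w, 0 <= h w) -> (forall w, `|f w| <= c * h w) ->
  P.-integrable setT (EFin \o f).
Proof.
move=> mf mh hoo h0 fh.
have ih : P.-integrable setT (EFin \o h).
  apply/integrableP; split; first exact/measurable_EFinP.
  by under eq_integral => w _ do rewrite /= ger0_norm //.
apply: (@le_integrable _ _ _ P setT _ _ (EFin \o (fun w => c * h w))) => //.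
- exact/measurable_EFinP.
- by move=> w _; rewrite /= lee_fin (le_trans (fh w)) // ler_norm.
- exact: (integrableZl measurableT c ih).
Qed.

(** Integration of the pointwise bound leaves at most [1 + 0 + 2 * a], which [expR (2 * a)]
    dominates. In both uses [h] is the exponential of [x ^ 2 / L ^ 2], of mean at most 2. *)
Lemma integral_expR_le (y h : T -> R) (a : R) :
  measurable_fun setT y -> measurable_fun setT h ->
  (forall w, 0 <= h w) -> (\int[P]_w (h w)%:E <= 2%:E)%E ->
  P.-integrable setT (EFin \o y) -> (\int[P]_w (y w)%:E = 0)%E ->
  0 <= a -> (forall w, expR (y w) <= 1 + y w + a * h w) ->
  (\int[P]_w (expR (y w))%:E <= (expR (2 * a))%:E)%E.
Proof.
move=> my mh h0 h2 iy y0 a0 le.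
have hoo : (\int[P]_w (h w)%:E < +oo)%E by apply: le_lt_trans h2 _; exact: ltry.
have ih : P.-integrable setT (EFin \o h).
  by apply: (@integrable_dominated h h 1) => // w; rewrite mul1r ger0_norm.
have i1 : P.-integrable setT (EFin \o (fun=> 1)) by exact: finite_measure_integrable_cst.
have iah : P.-integrable setT (fun w => a%:E * (h w)%:E)%E.
  exact: (integrableZl measurableT a ih).
apply: (@le_trans _ _ (\int[P]_w ((1%:E + (y w)%:E) + a%:E * (h w)%:E))%E).
  apply: ge0_le_integral => //.
  - by apply/measurable_EFinP; exact: measurableT_comp.
  - apply: emeasurable_funD; first by apply: emeasurable_funD => //; exact/measurable_EFinP.
    by apply: measurable_funeM; exact/measurable_EFinP.
  - by move=> w _; rewrite -EFinM -!EFinD lee_fin.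
rewrite integralD //; last exact: integrableD.
rewrite integralD // y0 adde0 integralZl //.
have -> : (\int[P]_w 1%:E = 1%:E)%E.
  by rewrite integral_cst // mul1e; exact: probability_setT.
have hf : (\int[P]_w (h w)%:E)%E \is a fin_num.
  by rewrite ge0_fin_numE //; apply: integral_ge0 => w _; rewrite lee_fin.
rewrite -(fineK hf) -EFinM -EFinD lee_fin.
have : fine (\int[P]_w (h w)%:E)%E <= 2 by rewrite -lee_fin fineK.
have := expR_ge1Dx (2 * a); nra.
Qed.

Section SubGaussian.
Variables (x : T -> R) (L : R).
Hypotheses (mx : measurable_fun setT x) (L0 : 0 < L).
Hypothesis psi : (\int[P]_w (expR (x w ^+ 2 / L ^+ 2))%:E <= 2%:E)%E.

Let h w := expR (x w ^+ 2 / L ^+ 2).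

Let mh : measurable_fun setT h.
Proof.
apply: measurableT_comp => //; apply: measurable_funM => //; exact: measurable_funX.
Qed.

Let h0 w : 0 <= h w. Proof. exact: expR_ge0. Qed.

Let hoo : (\int[P]_w (h w)%:E < +oo)%E.
Proof. by apply: le_lt_trans psi _; exact: ltry. Qed.

Let x_scaled w : x w ^+ 2 = L ^+ 2 * (x w ^+ 2 / L ^+ 2).
Proof. by rewrite mulrC divfK // expf_neq0 // gt_eqF. Qed.

Lemma subgaussian_integrable : P.-integrable setT (EFin \o x).
Proof.
apply: (@integrable_dominated x h (L + L)) => // w.
have z : 0 <= x w ^+ 2 / L ^+ 2 by rewrite divr_ge0 ?sqr_ge0.
have : `|x w / L| <= 1 + (x w / L) ^+ 2.
  rewrite -(real_normK (num_real (x w / L))).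
  by have := sqr_ge0 (`|x w / L| - 1); have := normr_ge0 (x w / L); nra.
rewrite normrM normfV (gtr0_norm L0) expr_div_n ler_pdivrMr // => H.
apply: (le_trans H); rewrite mulrC mulrDl -mulrDr ler_pM2l //.
have := expR_ge1Dx (x w ^+ 2 / L ^+ 2); rewrite -/(h w).
by have := h0 w; lra.
Qed.

Lemma subgaussian_square_integrable : P.-integrable setT (EFin \o (fun w => x w ^+ 2)).
Proof.
apply: (@integrable_dominated _ h (L ^+ 2)) => // [|w]; first exact: measurable_funX.
by rewrite ger0_norm ?sqr_ge0 // {1}x_scaled ler_wpM2l ?sqr_ge0 // expR_ge_id.
Qed.

(** Put [r = L ^ 2 * s ^ 2] and [z = x ^ 2 / L ^ 2]. If [4 * r <= 1], the quadratic remainder is at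
    most [2 * expR 1 * r * h], giving the exponent [4 * expR 1 * r]. Otherwise [s * x <= r + z]
    bounds the mean by [2 * expR r], and [1 < 4 * r] turns this into [expR (5 * r)]. The constant
    adds the two cases. *)
Lemma subgaussian_mgf (s : R) : (\int[P]_w (x w)%:E = 0)%E ->
  (\int[P]_w (expR (s * x w))%:E <= (expR ((4 * expR 1 + 5) * L ^+ 2 * s ^+ 2))%:E)%E.
Proof.
move=> Ex0; have LL : 0 < L ^+ 2 by rewrite exprn_gt0.
have e0 : 0 < expR 1 :> R by exact: expR_gt0.
have [s_small|s_large] := leP (4 * L ^+ 2 * s ^+ 2) 1.
  apply: (@le_trans _ _ (expR (2 * (2 * expR 1 * L ^+ 2 * s ^+ 2)))%:E); last first.
    by rewrite lee_fin ler_expR; have := sqr_ge0 s; nra.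
  apply: (@integral_expR_le _ h) => //.
  - exact: measurable_funM.
  - by apply: (integrableZl measurableT s subgaussian_integrable).
  - under eq_integral => w _ do rewrite EFinM.
    by rewrite integralZl // ?Ex0 ?mule0 //; exact: subgaussian_integrable.
  - by rewrite mulr_ge0 ?sqr_ge0 // mulr_ge0 ?(ltW LL) // mulr_ge0 // ltW.
  move=> w; apply: (le_trans (expR_le_quadratic _)); rewrite lerD2l.
  set z := x w ^+ 2 / L ^+ 2.
  have z0 : 0 <= z by rewrite divr_ge0 ?sqr_ge0.
  have -> : (s * x w) ^+ 2 * expR `|s * x w| = L ^+ 2 * s ^+ 2 * (z * expR `|s * x w|).
    by rewrite exprMn x_scaled -/z; ring.
  have -> : 2 * expR 1 * L ^+ 2 * s ^+ 2 * h w = L ^+ 2 * s ^+ 2 * (2 * expR 1 * h w) by ring.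
  apply: ler_wpM2l; first by rewrite mulr_ge0 ?sqr_ge0 // ltW.
  have sx : `|s * x w| <= 1 + z / 2.
    have : (s * x w) ^+ 2 <= z / 4.
      by rewrite exprMn x_scaled -/z; nra.
    rewrite -(real_normK (num_real (s * x w))).
    by have := sqr_ge0 (`|s * x w| - 1); have := normr_ge0 (s * x w); nra.
  apply: (@le_trans _ _ ((2 * expR (z / 2)) * expR (1 + z / 2))).
    rewrite ler_pM ?expR_ge0 ?ler_expR //.
    by have := expR_ge_id (z / 2); lra.
  rewrite expRD /h -/z (_ : expR z = expR (z / 2) * expR (z / 2)); last first.
    by rewrite -expRD; congr expR; lra.
  by rewrite le_eqVlt; apply/orP; left; apply/eqP; ring.
have E1 : (\int[P]_w ((expR (L ^+ 2 * s ^+ 2))%:E * (h w)%:E)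
    <= (expR ((4 * expR 1 + 5) * L ^+ 2 * s ^+ 2))%:E)%E.
  rewrite ge0_integralZl_EFin //; [|by move=> w _; rewrite lee_fin|exact/measurable_EFinP].
  apply: (@le_trans _ _ ((expR (L ^+ 2 * s ^+ 2))%:E * 2%:E)%E).
    by apply: lee_wpmul2l => //; rewrite lee_fin expR_ge0.
  rewrite -EFinM lee_fin.
  apply: (@le_trans _ _ (expR (L ^+ 2 * s ^+ 2) * expR 1)).
    by rewrite ler_wpM2l ?expR_ge0 //; have := expR_ge1Dx (1 : R); lra.
  by rewrite -expRD ler_expR; nra.
apply: le_trans E1; apply: ge0_le_integral => //.
- by apply/measurable_EFinP; apply: measurableT_comp => //; exact: measurable_funM.
- by apply: measurable_funeM; exact/measurable_EFinP.
move=> w _; rewrite -EFinM lee_fin -expRD ler_expR.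
set z := x w ^+ 2 / L ^+ 2.
have z0 : 0 <= z by rewrite divr_ge0 ?sqr_ge0.
have : (s * x w) ^+ 2 = L ^+ 2 * s ^+ 2 * z by rewrite exprMn x_scaled -/z; ring.
have := mulr_ge0 (sqr_ge0 L) (sqr_ge0 s).
move: (L ^+ 2 * s ^+ 2) (s * x w) => r y r0 yE.
have [y0|y0] := leP y 0; first lra.
rewrite -ler_sqr ?nnegrE ?addr_ge0 //; last exact: ltW.
by rewrite yE; have := sqr_ge0 (r - z); nra.
Qed.

(** A square is only subexponential, hence the restriction on [s]. With [r] and [z] as set below,
    [|y| <= r * z <= z / 2], and [z ^ 2 <= 16 * expR (z / 2)], so the remainder is at most
    [16 * r ^ 2 * expR z]. The centring by 1 produces the factor [expR (L ^- 2)]. *)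
Lemma subgaussian_square_mgf (s : R) : (\int[P]_w (x w ^+ 2)%:E = 1)%E ->
  2 * L ^+ 2 * `|s| <= 1 ->
  (\int[P]_w (expR (s * (x w ^+ 2 - 1)))%:E <=
   (expR (32 * expR (L ^- 2) * L ^+ 4 * s ^+ 2))%:E)%E.
Proof.
move=> Ex1 s_small; have LL : 0 < L ^+ 2 by rewrite exprn_gt0.
pose y w := s * (x w ^+ 2 - 1).
have my : measurable_fun setT y.
  by apply: measurable_funM => //; apply: measurable_funB => //; exact: measurable_funX.
have i1 : P.-integrable setT (EFin \o (fun=> -1)) by exact: finite_measure_integrable_cst.
have iB : P.-integrable setT (fun w => (x w ^+ 2)%:E + (-1)%:E)%E.
  by apply: integrableD => //; exact: subgaussian_square_integrable.
have -> : 32 * expR (L ^- 2) * L ^+ 4 * s ^+ 2 = 2 * (16 * expR (L ^- 2) * L ^+ 4 * s ^+ 2).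
  by ring.
apply: (@integral_expR_le y h) => //.
- exact: (integrableZl measurableT s iB).
- under eq_integral => w _ do rewrite /y EFinM EFinB.
  rewrite integralZl // integralD //; last exact: subgaussian_square_integrable.
  have -> : (\int[P]_w (-1)%:E = (-1)%:E)%E.
    rewrite integral_cst // -[RHS]mule1; congr (_ * _)%E; exact: probability_setT.
  by rewrite Ex1 -EFinD subrr mule0.
- by rewrite mulr_ge0 ?sqr_ge0 // mulr_ge0 ?exprn_ge0 ?(ltW L0) // mulr_ge0 // expR_ge0.
move=> w; apply: (le_trans (expR_le_quadratic _)); rewrite lerD2l.
set r := L ^+ 2 * `|s|; set z := x w ^+ 2 / L ^+ 2 + L ^- 2.
have z0 : 0 <= z by rewrite addr_ge0 ?invr_ge0 ?divr_ge0 ?sqr_ge0 // ltW.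
have r0 : 0 <= r by rewrite mulr_ge0 ?sqr_ge0.
have r12 : r <= 1 / 2 by rewrite /r; lra.
have yz : `|y w| <= r * z.
  rewrite /y normrM /r /z (_ : _ * (_ + _) = `|s| * (x w ^+ 2 + 1)); last first.
    by field; rewrite gt_eqF.
  by rewrite ler_wpM2l // ler_norml; apply/andP; split; have := sqr_ge0 (x w); lra.
have -> : 16 * expR (L ^- 2) * L ^+ 4 * s ^+ 2 * h w = r ^+ 2 * (16 * expR z).
  rewrite /z expRD /h /r exprMn (real_normK (num_real s)); ring.
rewrite -(real_normK (num_real (y w))).
apply: (@le_trans _ _ ((r * z) ^+ 2 * expR (z / 2))).
  rewrite ler_pM ?expR_ge0 ?sqr_ge0 //.
    by rewrite ler_sqr ?nnegrE // mulr_ge0.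
  by rewrite ler_expR (le_trans yz) //; nra.
rewrite exprMn -mulrA ler_wpM2l ?sqr_ge0 //.
have z4 := expR_ge_id (z / 4).
have -> : expR z = expR (z / 4) ^+ 2 * expR (z / 2).
  by rewrite expr2 -!expRD; congr expR; field.
rewrite mulrA ler_wpM2r ?expR_ge0 //.
have : (z / 4) ^+ 2 <= expR (z / 4) ^+ 2 by rewrite ler_sqr ?nnegrE ?expR_ge0 // divr_ge0.
by rewrite expr_div_n; lra.
Qed.
End SubGaussian.

(** An infimum may fail to be attained; below [K + 1] there is an admissible [t], and the
    exponential moment only decreases as [t] grows. *)
Lemma psi2_norm_le (x : T -> R) (K : R) : measurable_fun setT x ->
  (psi2_norm P x <= K%:E)%E ->
  0 < K + 1 /\ (\int[P]_w (expR (x w ^+ 2 / (K + 1) ^+ 2))%:E <= 2%:E)%E.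
Proof.
move=> mx psi.
have : (psi2_norm P x < (K + 1)%:E)%E by apply: le_lt_trans psi _; rewrite lte_fin; lra.
move=> /ereal_inf_lt[_ [t [t0 tE] <-]]; rewrite lte_fin => tK.
have K0 : 0 < K + 1 by apply: lt_trans tK.
have mq (c : R) : measurable_fun setT (fun w => (expR (x w ^+ 2 / c))%:E).
  apply/measurable_EFinP; apply: measurableT_comp => //; apply: measurable_funM => //.
  exact: measurable_funX.
split => //; move: tE; rewrite unlock; apply: le_trans; apply: ge0_le_integral => //.
move=> w _; rewrite lee_fin ler_expR ler_wpM2l ?sqr_ge0 //.
by rewrite lef_pV2 ?posrE ?exprn_gt0 // ler_sqr ?nnegrE ?ltW.
Qed.
End Moments.

(** * High-probability events for the noise *)

Section NoiseEvents.
Context (R : realType) (d : measure_display) (T : measurableType d) (P : probability T R).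

Lemma measure_union_le (I : eqType) (s : seq I) (F : I -> set T) (e : R) :
  (forall i, measurable (F i)) -> (forall i, i \in s -> (P (F i) <= e%:E)%E) ->
  exists2 B, measurable B /\ (P B <= ((size s)%:R * e)%:E)%E &
    forall w, ~ B w -> forall i, i \in s -> ~ F i w.
Proof.
move=> mF; elim: s => [|i s IH] Fe.
  by exists set0 => //; rewrite measure0 mul0r.
have [j js|B [mB PB] BF] := IH; first by apply: Fe; rewrite inE js orbT.
exists (F i `|` B); first split.
- exact: measurableU.
- apply: (le_trans (measureU2 _ _ _)) => //.
  rewrite /= -natr1 mulrDl mul1r addrC EFinD; apply: leeD => //.
  by apply: Fe; rewrite mem_head.
by move=> w /not_orP[nF nB] j; rewrite inE => /orP[/eqP ->|/BF]; last exact.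
Qed.

Variables (p N : nat) (K : R) (X : T -> 'M[R]_(p, N)).
Hypothesis noise : noise_matrix P K X.
Let L := K + 1.

Let mX (e : 'I_p * 'I_N) : measurable_fun setT (fun w => X w e.1 e.2).
Proof. by case: noise. Qed.

Lemma noise_entry (e : 'I_p * 'I_N) :
  [/\ 0 < L, (\int[P]_w (expR (X w e.1 e.2 ^+ 2 / L ^+ 2))%:E <= 2%:E)%E,
      (\int[P]_w (X w e.1 e.2)%:E = 0)%E & (\int[P]_w (X w e.1 e.2 ^+ 2)%:E = 1)%E].
Proof.
case: noise => mX' _ /(_ e.1 e.2)[E0 V1 _ psi].
have [L0 psi'] := psi2_norm_le (mX e) psi.
split => //; first by move: E0; rewrite unlock.
move: V1; rewrite /variance unlock E0 /= unlock => <-.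
apply: eq_integral => w _; congr EFin.
by rewrite -[RHS]/((X w e.1 e.2 - 0) * (X w e.1 e.2 - 0)) !subr0 expr2.
Qed.

Lemma measurable_sum_ge (f : 'I_p * 'I_N -> R -> R) (a : R) :
  (forall e, measurable_fun setT (f e)) ->
  measurable [set w | a <= \sum_e f e (X w e.1 e.2)].
Proof.
move=> mf; have -> : [set w | a <= \sum_e f e (X w e.1 e.2)] =
    (fun w => \sum_e f e (X w e.1 e.2)) @^-1` `[a, +oo[%classic.
  by apply/seteqP; split=> w; rewrite /= in_itv /= andbT.
rewrite -[X in measurable X]setTI.
have : measurable_fun setT (fun w => \sum_e f e (X w e.1 e.2)).
  by apply: measurable_sum => e; exact: (measurableT_comp (mf e) (mX e)).
by apply.
Qed.

Definition mgf_constant : R := (4 * expR 1 + 5) * L ^+ 2.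

(** Tilting by [q], the square root of [M = p + N], gives each net point the Chernoff exponent
    [mgf_constant * M - t * M = - 36 * M]. There are at most [2 ^ (33 * M + 1)] events (two grids
    and a sign), so the union bound leaves at most [expR (- M)], hence at most [1 / M]; this fixes
    the [36]. *)
Lemma noise_op_event : (0 < p + N)%N ->
  exists2 B, measurable B /\ (P B <= (((p + N)%:R)^-1)%:E)%E &
    forall w, ~ B w -> op_le (X w)^T (64 * (mgf_constant + 36) ^+ 2 * (p + N)%:R).
Proof.
move=> M0; set M := (p + N)%N in M0 *; set t := mgf_constant + 36.
have M0' : 0 < M%:R :> R by rewrite ltr0n.
pose q := Num.sqrt (M%:R : R); pose h := 4 * q.
have q0 : 0 < q by rewrite sqrtr_gt0.
have qq : q ^+ 2 = M%:R by rewrite sqr_sqrtr // ltW.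
have h0 : 0 < h by rewrite mulr_gt0.
have hM : h ^+ 2 = (16 * M)%:R by rewrite exprMn qq natrM -natrX.
pose gv m (a : m.-tuple 'I_(16 * M).+1) : 'cV[R]_m := grid_vector h a.
pose D := [set x : (p.-tuple 'I_(16 * M).+1 * N.-tuple 'I_(16 * M).+1) * bool |
  [&& x.1.1 \in grid p (16 * M), x.1.2 \in grid N (16 * M),
      normsq (gv _ x.1.1) <= 1 & normsq (gv _ x.1.2) <= 1]]%SET.
have cardD : (#|D| <= 2 ^ (33 * M + 1))%N.
  apply: (@leq_trans #|finset.setX (finset.setX (grid p (16 * M)) (grid N (16 * M))) [set: bool]%SET|).
    by apply/subset_leq_card/fintype.subsetP => -[[a b] c]; rewrite !inE /= => /and4P[-> ->].
  rewrite !cardsX cardsT card_bool [(33 * M + 1)%N](_ : _ = p + 16 * M + (N + 16 * M) + 1)%N.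
    by rewrite expnD expn1 leq_mul2r expnD leq_mul ?card_grid ?orbT.
  by rewrite addnACA -/M -mulnDl -mulSn.
pose f (x : (p.-tuple 'I_(16 * M).+1 * N.-tuple 'I_(16 * M).+1) * bool)
    (e : 'I_p * 'I_N) (y : R) :=
  (-1) ^+ x.2 * q * gv _ x.1.1 e.1 0 * gv _ x.1.2 e.2 0 * y.
have mf x e : measurable_fun setT (f x e) by exact: measurable_funM.
have sumf x w : \sum_e f x e (X w e.1 e.2) =
    (-1) ^+ x.2 * q * bilin (X w) (gv _ x.1.1) (gv _ x.1.2).
  rewrite /bilin pair_bigA mulr_sumr; apply: eq_bigr => e _; rewrite /f /=; ring.
have Pf x : x \in D -> (P [set w | (t * M%:R <= \sum_e f x e (X w e.1 e.2))%R] <=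
    (expR (- (36 * M%:R)))%:E)%E.
  rewrite inE => /and4P[_ _ a1 b1].
  have [_ indep _] := noise.
  pose b (e : 'I_p * 'I_N) :=
    mgf_constant * ((-1) ^+ x.2 * q * gv _ x.1.1 e.1 0 * gv _ x.1.2 e.2 0) ^+ 2.
  apply: (le_trans (@chernoff _ _ _ P _ _ (f x) b (t * M%:R) mX indep (mf x) _)).
    move=> e; have [L0 psi Ex0 _] := noise_entry e.
    exact: (subgaussian_mgf (mX e) L0 psi).
  rewrite lee_fin ler_expR.
  have -> : \sum_e b e = mgf_constant * M%:R * (normsq (gv _ x.1.1) * normsq (gv _ x.1.2)).
    rewrite !normsq_cVE mulr_suml mulr_sumr; under [RHS]eq_bigr do rewrite mulr_sumr mulr_sumr.
    rewrite pair_bigA; apply: eq_bigr => e _ /=.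
    by rewrite /b !exprMn qq sqrr_sign; ring.
  have C0 : 0 <= mgf_constant.
    by rewrite mulr_ge0 ?sqr_ge0 // addr_ge0 // mulr_ge0 // expR_ge0.
  have ab1 : normsq (gv _ x.1.1) * normsq (gv _ x.1.2) <= 1.
    by rewrite mulr_ile1 ?normsq_ge0.
  have := ler_wpM2l (mulr_ge0 C0 (ltW M0')) ab1; rewrite mulr1 /t; lra.
have [B [mB PB] BF] := @measure_union_le _ (enum D)
  (fun x => [set w | t * M%:R <= \sum_e f x e (X w e.1 e.2)]) _
  (fun x => measurable_sum_ge _ (mf x)) (fun x xD => Pf x (etrans (esym (mem_enum _ _)) xD)).
exists B; first split => //.
  apply: (le_trans PB); rewrite lee_fin -cardE.
  apply: (@le_trans _ _ (expR ((33 * M + 1)%:R) * expR (- (36 * M%:R)))).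
    rewrite ler_wpM2r ?expR_ge0 //; apply: (@le_trans _ _ ((2 ^ (33 * M + 1))%:R)).
      by rewrite ler_nat.
    rewrite natrX -[X in expR X]mulr1 expRM_natl lerXn2r ?nnegrE ?expR_ge0 //.
    by have := expR_ge1Dx (1 : R); lra.
  have M1 : 1 <= M%:R :> R by rewrite ler1n.
  rewrite -expRD; apply: (@le_trans _ _ (expR (- M%:R))).
    by rewrite ler_expR natrD natrM; lra.
  by rewrite expRN lef_pV2 ?posrE ?expR_gt0 // expR_ge_id.
move=> w nB.
have -> : 64 * t ^+ 2 * M%:R = 64 * (t * q) ^+ 2 by rewrite exprMn qq; ring.
apply: (op_le_net M0 (leq_addr _ _) (leq_addl _ _) h0 hM) => a b ga gb a1 b1.
have half (c : bool) : (-1) ^+ c * bilin (X w) (gv _ a) (gv _ b) <= t * q.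
  have := BF w nB ((a, b), c).
  rewrite mem_enum inE /= ga gb a1 b1 => /(_ isT)/negP; rewrite -ltNge sumf /= => lt.
  rewrite -(ler_pM2l q0) mulrA [q * _]mulrC (le_trans (ltW lt)) // -qq.
  by rewrite le_eqVlt; apply/orP; left; apply/eqP; ring.
by have := half true; have := half false; rewrite /= mul1r mulN1r ler_norml lerNl => -> ->.
Qed.

Definition square_mgf_constant : R := 32 * expR (L ^- 2) * L ^+ 4.

(** The tilt [s = tau / (2 * C)] minimises [N * (C * s ^ 2 - s * tau)], with value
    [- N * tau ^ 2 / (4 * C)]. The premise on [tau] is the restriction on [s] in
    [subgaussian_square_mgf]. *)
Lemma noise_diag_event (tau : R) : 0 < tau -> L ^+ 2 * tau <= square_mgf_constant ->
  exists2 B, measurable B /\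
    (P B <= ((2 * p)%:R * expR (- (N%:R * tau ^+ 2 / (4 * square_mgf_constant))))%:E)%E &
    forall w, ~ B w -> forall i, `|\sum_mu (X w i mu ^+ 2 - 1)| <= N%:R * tau.
Proof.
move=> tau0 tau_small; set C := square_mgf_constant.
have [e0|p0] := pickP (fun _ : 'I_p * 'I_N => true); last first.
  exists set0; first by split=> //; rewrite measure0 lee_fin mulr_ge0 // expR_ge0.
  move=> w _ i; rewrite big1 ?normr0 ?mulr_ge0 ?(ltW tau0) // => mu _.
  by have := p0 (i, mu).
move=> _; have [L0 _ _ _] := noise_entry e0.
have C0 : 0 < C by rewrite mulr_gt0 ?exprn_gt0 // mulr_gt0 // expR_gt0.
pose s := tau / (2 * C).
have s0 : 0 < s by rewrite divr_gt0 // mulr_gt0.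
(* Vanishing off row [x.1] lets the independence of all entries serve for a single row; the boolean
   is a sign, so that one-sided bounds control the absolute value. *)
pose f (x : 'I_p * bool) (e : 'I_p * 'I_N) (y : R) :=
  if e.1 == x.1 then ((-1) ^+ x.2 * s) * (y ^+ 2 - 1) else 0.
have mf x e : measurable_fun setT (f x e).
  rewrite /f; case: eqP => // _; apply: measurable_funM => //.
  by apply: measurable_funB => //; exact: measurable_funX.
have sumf x (w : T) : \sum_e f x e (X w e.1 e.2) =
    (-1) ^+ x.2 * s * \sum_mu (X w x.1 mu ^+ 2 - 1).
  rewrite -(pair_bigA _ (fun i mu => f x (i, mu) (X w i mu))) /= (bigD1 x.1) //=.
  rewrite [X in _ + X]big1 ?addr0 => [|i /negbTE ix]; last first.
    by apply: big1 => mu _; rewrite /f /= ix.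
  by rewrite mulr_sumr; apply: eq_bigr => mu _; rewrite /f /= eqxx.
have Pf x : (P [set w | (s * (N%:R * tau) <= \sum_e f x e (X w e.1 e.2))%R] <=
    (expR (- (N%:R * tau ^+ 2 / (4 * C))))%:E)%E.
  have [_ indep _] := noise.
  pose b (e : 'I_p * 'I_N) := if e.1 == x.1 then C * s ^+ 2 else 0.
  apply: (le_trans (@chernoff _ _ _ P _ _ (f x) b _ mX indep (mf x) _)).
    move=> e; have [_ psi _ Ex1] := noise_entry e; rewrite /f /b; case: eqP => _.
      have -> : C * s ^+ 2 = C * ((-1) ^+ x.2 * s) ^+ 2 by rewrite [in RHS]exprMn sqrr_sign mul1r.
      apply: (subgaussian_square_mgf (mX e) L0 psi Ex1).
      rewrite normrM normrX normrN1 expr1n mul1r gtr0_norm // /s.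
      rewrite (_ : _ * _ = L ^+ 2 * tau / C); first by rewrite ler_pdivrMr // mul1r.
      by field; rewrite gt_eqF.
    by under eq_integral => w _ do rewrite expR0; rewrite integral_cst // mul1e expR0 probability_le1.
  rewrite lee_fin ler_expR.
  have -> : \sum_e b e = N%:R * (C * s ^+ 2).
    rewrite -(pair_bigA _ (fun i mu => b (i, mu))) /= (bigD1 x.1) //=.
    rewrite [X in _ + X]big1 ?addr0 => [|i /negbTE ix]; last first.
      by apply: big1 => mu _; rewrite /b /= ix.
    by rewrite /b /= eqxx sumr_const card_ord [RHS]mulr_natl.
  rewrite /s le_eqVlt; apply/orP; left; apply/eqP; field.
  by rewrite gt_eqF.
have [B [mB PB] BF] := @measure_union_le _ (enum {: 'I_p * bool})
  (fun x => [set w | s * (N%:R * tau) <= \sum_e f x e (X w e.1 e.2)]) _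
  (fun x => measurable_sum_ge _ (mf x)) (fun x _ => Pf x).
exists B; first split => //.
  apply: (le_trans PB); rewrite lee_fin ler_wpM2r ?expR_ge0 //.
  by rewrite -cardT card_prod card_ord card_bool mulnC.
move=> w nB i.
have half (c : bool) : (-1) ^+ c * \sum_mu (X w i mu ^+ 2 - 1) <= N%:R * tau.
  have := BF w nB (i, c); rewrite mem_enum => /(_ isT)/negP; rewrite -ltNge sumf /= => lt.
  by rewrite -(ler_pM2l s0) mulrA [s * _]mulrC ltW.
by have := half true; have := half false; rewrite /= mul1r mulN1r ler_norml lerNl => -> ->.
Qed.
End NoiseEvents.

(** * The signal lies in a fixed subspace almost surely *)

(** Needed because the law of a column is given on Borel sets. The space is the zero set of
    [v - projv U v], whose coordinates are linear combinations of those of [v], hence continuous. *)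
Lemma closed_vspace (R : realType) (p : nat) (U : {vspace 'cV[R]_p}) :
  closed [set v | v \in U].
Proof.
pose f (v : 'cV[R]_p) := v - projv U v.
have fE v j : f v j 0 = \sum_i v i 0 * f (delta_mx i 0) j 0.
  have -> : f v = \sum_i v i 0 *: f (delta_mx i 0).
    rewrite /f [in LHS](matrix_sum_delta v) raddf_sum -sumrB; apply: eq_bigr => i _ /=.
    by rewrite big_ord1 linearZ scalerBr.
  by rewrite summxE; apply: eq_bigr => i _; rewrite mxE.
have cf j : continuous (fun v => f v j 0).
  under [X in continuous X]eq_fun do rewrite fE.
  apply: continuous_big => [|i _ v]; first exact: add_continuous.
  apply: (@continuousM _ _ (fun v : 'cV[R]_p => v i 0) (cst (f (delta_mx i 0) j 0))); last exact: cst_continuous.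
  exact: coord_continuous.
have -> : [set v | v \in U] = \bigcap_j ((fun v => f v j 0) @^-1` [set 0]).
  apply/seteqP; split=> [v /= vU j _ /=|v H /=]; first by rewrite /f projv_id // subrr mxE.
  have : f v = 0 by apply/matrixP => i j; rewrite ord1 [RHS]mxE; exact: H.
  by move/eqP; rewrite subr_eq0 => /eqP ->; exact: memv_proj.
apply: closed_bigI => j _; apply: preimage_closed; last exact: closed_eq.
by move=> v _; exact: cf.
Qed.

Lemma signal_columns_event (R : realType) (d : measure_display) (T : measurableType d)
    (P : probability T R) (M : ptopologicalType) (PM : probability (borelType M) R)
    (p N : nat) (iota : M -> 'cV[R]_p) (S : T -> 'M[R]_(p, N)) (U : {vspace 'cV[R]_p}) :
  signal_matrix P PM iota S -> (forall v, range iota v -> v \in U) ->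
  exists2 B, measurable B /\ (P B <= 0)%E & forall w, ~ B w -> forall mu, col mu (S w) \in U.
Proof.
move=> [mS _ law _] iU.
pose V : set (borelType 'cV[R]_p) := [set v | v \in U].
have mV : measurable (~` V).
  have oV : open (~` [set v : 'cV[R]_p | v \in U]).
    by apply: closed_openC; exact: closed_vspace.
  exact: sub_sigma_algebra oV.
pose F mu : set T := (fun w => col mu (S w) : borelType 'cV[R]_p) @^-1` (~` V).
have mF mu : measurable (F mu) by rewrite -[X in measurable X]setTI; exact: (mS mu).
have F0 mu : mu \in enum 'I_N -> (P (F mu) <= 0%:E)%E.
  move=> _; rewrite law // (_ : iota @^-1` _ = set0) ?measure0 //.
  by apply/seteqP; split=> // x; apply; apply: iU; exists x.
have [B [mB PB] BF] := measure_union_le mF F0.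
exists B; first by split => //; rewrite mulr0 in PB.
move=> w nB mu; have := BF w nB mu; rewrite mem_enum => /(_ isT) H.
by apply: contrapT => nU; exact: H.
Qed.

(** * From the events to the rate at fixed dimensions *)

Section ResidualBound.
Variables (R : realType) (p N n : nat) (s_max b tau : R) (sigma : 'rV[R]_p).
Variables (U : {vspace 'cV[R]_p}) (S X : 'M[R]_(p, N)) (C : 'M[R]_p).
Hypotheses (N0 : (0 < N)%N) (s_max0 : 0 <= s_max) (b0 : 0 <= b).
Hypothesis sigma_itv : forall i, 0 <= sigma 0 i <= s_max.
Hypotheses (dimU : \dim U = n) (SU : forall mu, col mu S \in U).
Hypothesis opX : op_le X^T b.
Hypothesis diagX : forall i, `|\sum_mu (X i mu ^+ 2 - 1)| <= N%:R * tau.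
Let Q := sample_covariance (observation sigma S X).
Hypothesis trunc : spectral_truncation n Q C.

Lemma residual_variance_sqdist :
  sqdist (residual_variance Q C) sigma <=
  2 * (p%:R * (s_max * tau) ^+ 2) + 2 * ((12 * n)%:R * (s_max * b / N%:R) ^+ 2).
Proof.
have [B [S' SE]] := columns_factor dimU SU.
pose Z := diag_mx (map_mx Num.sqrt sigma) *m X.
have N0' : 0 < N%:R :> R by rewrite ltr0n.
have opZ : op_le Z^T (s_max * b).
  move=> u; rewrite trmx_mul tr_diag_mx -mulmxA; apply: (le_trans (opX _)).
  rewrite [s_max * b]mulrC -mulrA ler_wpM2l //; apply: normsq_diag_mx_le => i.
  by have /andP[? ?] := sigma_itv i; rewrite mxE sqr_sqrtr.
have QE : Q = sample_covariance (B *m S' + Z) by rewrite -SE.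
have residual := residual_diag_bound (mulr_ge0 s_max0 b0) opZ QE trunc.
have WE i : sample_covariance Z i i - sigma 0 i =
    sigma 0 i / N%:R * \sum_mu (X i mu ^+ 2 - 1).
  have /andP[s0 _] := sigma_itv i.
  have ZE mu : Z i mu = Num.sqrt (sigma 0 i) * X i mu by rewrite /Z mul_diag_mx !mxE.
  rewrite sumrB sumr_const card_ord -[1 *+ N]/(N%:R) mulrBr divfK ?gt_eqF //.
  congr (_ - _); rewrite /sample_covariance mxE.
  have -> : (Z *m Z^T) i i = \sum_mu Z i mu ^+ 2.
    by rewrite mxE; apply: eq_bigr => mu _; rewrite [Z^T _ _]mxE expr2.
  rewrite !mulr_sumr; apply: eq_bigr => mu _.
  by rewrite ZE exprMn sqr_sqrtr //; ring.
have W_le i : (sample_covariance Z i i - sigma 0 i) ^+ 2 <= (s_max * tau) ^+ 2.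
  have /andP[s0 s1] := sigma_itv i.
  rewrite WE -(real_normK (num_real (_ * _))) normrM ger0_norm ?divr_ge0 ?(ltW N0') //.
  have le : sigma 0 i / N%:R * `|\sum_mu (X i mu ^+ 2 - 1)| <= s_max * tau.
    apply: (@le_trans _ _ (sigma 0 i / N%:R * (N%:R * tau))).
      by rewrite ler_wpM2l ?divr_ge0 // ltW.
    rewrite mulrA divfK ?gt_eqF // ler_wpM2r //.
    by rewrite -(pmulr_rge0 _ N0') (le_trans _ (diagX i)).
  have ge : 0 <= sigma 0 i / N%:R * `|\sum_mu (X i mu ^+ 2 - 1)|.
    by rewrite mulr_ge0 ?divr_ge0 // ltW.
  by rewrite ler_sqr ?nnegrE // (le_trans ge).
apply: (@le_trans _ _ (2 * \sum_i (sample_covariance Z i i - sigma 0 i) ^+ 2 +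
  2 * \sum_i ((Q - C) i i - sample_covariance Z i i) ^+ 2)).
  rewrite /sqdist !mulr_sumr -big_split /=; apply: ler_sum => i _.
  rewrite [residual_variance _ _ 0 i]mxE; move: ((Q - C) i i) (sample_covariance Z i i) => x y.
  by have := sqr_ge0 ((x - y) - (y - sigma 0 i)); nra.
apply: lerD; rewrite ler_wpM2l //.
apply: (@le_trans _ _ (\sum_(i < p) (s_max * tau) ^+ 2)); first exact: ler_sum.
by rewrite sumr_const card_ord [leRHS]mulr_natl.
Qed.
End ResidualBound.

(** Here [64 = 4 * 2 * 8] and [96 = 4 * 2 * 12]: the [4] is from the Potts comparison, the [2] from
    splitting the residual error, the [8] from [tau ^ 2], the [12] from [residual_diag_bound]. The
    factor [2 * phi + 1] bounds [(p + N) / N], and [2 / phi] turns a constant into a multiple of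
    [p * rate]. *)
Definition rate_constant (R : realType) (n : nat) (K s_max phi c : R) : R :=
  64 * s_max ^+ 2 * square_mgf_constant K + 2 * c +
  96 * n%:R * (s_max * (64 * (mgf_constant K + 36) ^+ 2) * (2 * phi + 1)) ^+ 2 * (2 / phi).

Section FixedDimensions.
Context (R : realType) (d : measure_display) (T : measurableType d) (P : probability T R).
Context (M : ptopologicalType) (PM : probability (borelType M) R).
Variables (p N n : nat) (K s_max phi c : R) (iota : M -> 'cV[R]_p) (sigma : 'rV[R]_p).
Variables (X S : T -> 'M[R]_(p, N)).
Hypotheses (noise : noise_matrix P K X) (signal : signal_matrix P PM iota S).
Hypothesis span : linear_span_dim n (range iota).
Hypotheses (s_max0 : 0 <= s_max) (sigma_itv : forall i, 0 <= sigma 0 i <= s_max).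
Hypotheses (c0 : 0 < c) (phi0 : 0 < phi).
Hypotheses (p0 : (0 < p)%N) (N0 : (0 < N)%N) (lnp : 1 <= ln p%:R :> R).
Hypotheses (pN_ge : phi / 2 <= p%:R / N%:R) (pN_le : p%:R / N%:R <= 2 * phi).
Hypothesis rate_small : 8 * (K + 1) ^+ 4 * (ln p%:R / N%:R) <= square_mgf_constant K.

Let rate : R := ln p%:R / N%:R.

(** [E] is chosen before [C] and [sigma_pwc], hence is measurable whatever they are. The loss
    [3 / p] is [1 / (p + N)] for the operator norm, [2 / p] for the diagonal and [0] for the
    signal. *)
Lemma rate_event : exists2 E : set T,
  measurable E /\ ((1 - 3 / p%:R)%:E <= P E)%E &
  forall w, E w -> forall C sigma_pwc,
    let Q := sample_covariance (observation sigma (S w) (X w)) in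
    spectral_truncation n Q C ->
    potts_argmin (c * ln p%:R / N%:R) (residual_variance Q C) sigma_pwc ->
    p%:R^-1 * sqdist sigma_pwc sigma <= rate_constant n K s_max phi c * rate.
Proof.
have p0' : 0 < p%:R :> R by rewrite ltr0n.
have N0' : 0 < N%:R :> R by rewrite ltr0n.
have lnp0 : 0 < ln p%:R :> R by apply: lt_le_trans lnp.
have rate0 : 0 < rate by rewrite divr_gt0.
have [L0 _ _ _] := noise_entry noise (Ordinal p0, Ordinal N0).
have C20 : 0 < square_mgf_constant K.
  by rewrite mulr_gt0 ?exprn_gt0 // mulr_gt0 // expR_gt0.
have small := rate_small; set C2 := square_mgf_constant K in small C20.
(* With this choice the union bound over [2 p] Chernoff events gives [2 / p]. *)
pose tau := Num.sqrt (8 * C2 * rate).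
have tau0 : 0 < tau by rewrite sqrtr_gt0 mulr_gt0 // mulr_gt0.
have tau2 : tau ^+ 2 = 8 * C2 * rate by rewrite sqr_sqrtr // ltW // mulr_gt0 // mulr_gt0.
have tau_small : (K + 1) ^+ 2 * tau <= C2.
  rewrite -ler_sqr ?nnegrE ?(ltW C20) //; last by rewrite mulr_ge0 ?sqr_ge0 // ltW.
  have -> : ((K + 1) ^+ 2 * tau) ^+ 2 = C2 * (8 * (K + 1) ^+ 4 * rate).
    by rewrite [LHS]exprMn tau2; ring.
  by rewrite expr2 ler_pM2l.
have M0 : (0 < p + N)%N by rewrite addn_gt0 p0.
have [B1 [mB1 PB1] B1F] := noise_op_event noise M0.
have [B2 [mB2 PB2] B2F] := noise_diag_event noise tau0 tau_small.
have [U [SU _ dimU]] := span.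
have [B3 [mB3 PB3] B3F] := signal_columns_event signal SU.
have mB : measurable (B1 `|` B2 `|` B3) by apply: measurableU => //; exact: measurableU.
exists (~` (B1 `|` B2 `|` B3)); first split; first exact: measurableC.
  rewrite probability_setC // EFinB leeB //.
  apply: (le_trans (measureU2 _ _ _)) => //; first exact: measurableU.
  rewrite -[leRHS]adde0; apply: leeD => //.
  apply: (le_trans (measureU2 _ _ _)) => //; apply: (le_trans (leeD PB1 PB2)).
  rewrite -EFinD lee_fin.
  have -> : N%:R * tau ^+ 2 / (4 * C2) = 2%:R * ln p%:R.
    by rewrite tau2 /rate; field; rewrite !gt_eqF.
  rewrite expRN expRM_natl lnK ?posrE // natrM.
  have -> : 2 * p%:R / p%:R ^+ 2 = 2 / p%:R :> R by field; rewrite gt_eqF.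
  have -> : 3 / p%:R = p%:R^-1 + 2 / p%:R :> R by field; rewrite gt_eqF.
  rewrite lerD2r lef_pV2 ?posrE // ?ltr0n // ler_nat leq_addr //.
move=> w /not_orP[/not_orP[nB1 nB2] nB3] C sigma_pwc Q trunc argmin.
set t := mgf_constant K + 36.
have b0 : 0 <= 64 * t ^+ 2 * (p + N)%:R by rewrite mulr_ge0 // mulr_ge0 // sqr_ge0.
have := residual_variance_sqdist N0 s_max0 b0 sigma_itv dimU (B3F w nB3) (B1F w nB1)
  (B2F w nB2) trunc.
have beta0 : 0 <= c * ln p%:R / N%:R by rewrite -mulrA mulr_ge0 ?ltW.
have := potts_argmin_sqdist sigma beta0 argmin; rewrite -/Q => le1 le2.
have ratio : (p + N)%:R / N%:R <= 2 * phi + 1.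
  by rewrite natrD mulrDl mulfV ?gt_eqF // lerD2r.
have {}ratio : (s_max * (64 * t ^+ 2 * (p + N)%:R) / N%:R) ^+ 2 <=
    (s_max * (64 * t ^+ 2) * (2 * phi + 1)) ^+ 2.
  rewrite (_ : s_max * (64 * t ^+ 2 * (p + N)%:R) / N%:R =
    s_max * (64 * t ^+ 2) * ((p + N)%:R / N%:R)); last by rewrite !mulrA.
  have st : 0 <= s_max * (64 * t ^+ 2) by rewrite mulr_ge0 // mulr_ge0 // sqr_ge0.
  have r0 : 0 <= (p + N)%:R / N%:R :> R by rewrite divr_ge0.
  have g0 : 0 <= 2 * phi + 1 by rewrite addr_ge0 // mulr_ge0 // ltW.
  by rewrite ler_sqr; [exact: ler_wpM2l | exact: mulr_ge0 | exact: mulr_ge0].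
set G := (s_max * (64 * t ^+ 2) * (2 * phi + 1)) ^+ 2 in ratio.
have G0 : 0 <= G by rewrite sqr_ge0.
(* This absorbs the dimension-free contribution of [D] into the rate: [p / N >= phi / 2] and
   [ln p >= 1]. *)
have p_rate : 1 <= 2 / phi * rate * p%:R.
  have -> : 2 / phi * rate * p%:R = (2 / phi * (p%:R / N%:R)) * ln p%:R by rewrite /rate; ring.
  rewrite -[leLHS]mulr1 ler_pM //.
  have e1 : 2 / phi * (phi / 2) = 1 by field; rewrite gt_eqF.
  rewrite -[leLHS]e1.
  by rewrite ler_wpM2l // divr_ge0 // ltW.
rewrite ler_pdivrMl //.
apply: (le_trans le1).
have le3 : (12 * n)%:R * (s_max * (64 * t ^+ 2 * (p + N)%:R) / N%:R) ^+ 2 <=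
    12 * n%:R * G * (2 / phi * rate * p%:R).
  rewrite natrM; apply: (@le_trans _ _ (12 * n%:R * G)); first by rewrite ler_wpM2l.
  by rewrite ler_peMr // mulr_ge0.
rewrite /rate_constant -/C2 -/t -/G.
have -> : p%:R * ((64 * s_max ^+ 2 * C2 + 2 * c + 96 * n%:R * G * (2 / phi)) * rate) =
  4 * (2 * (p%:R * (s_max * tau) ^+ 2) + 2 * (12 * n%:R * G * (2 / phi * rate * p%:R))) +
  2 * (c * rate) * p%:R by rewrite exprMn tau2; ring.
rewrite -[c * ln _ / _]mulrA -/rate lerD2r ler_wpM2l //.
apply: (le_trans le2); rewrite lerD2l ler_wpM2l //.
Qed.
End FixedDimensions.

Lemma rate_constant_gt0 (R : realType) (n : nat) (K s_max phi c : R) :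
  0 < square_mgf_constant K -> 0 < phi -> 0 < c -> 0 < rate_constant n K s_max phi c.
Proof.
move=> C0 phi0 c0; rewrite /rate_constant; apply: ltr_wpDr.
  by rewrite mulr_ge0 ?divr_ge0 ?(ltW phi0) // mulr_ge0 ?sqr_ge0.
apply: ltr_wpDl; last by rewrite mulr_gt0.
by rewrite mulr_ge0 ?(ltW C0) // mulr_ge0 ?sqr_ge0.
Qed.

(** * Passage to the limit *)

Lemma ln_le_sqrt (R : realType) (x : R) : 0 < x -> ln x <= 2 * Num.sqrt x.
Proof.
move=> x0; have s0 : 0 < Num.sqrt x by rewrite sqrtr_gt0.
rewrite -{1}(sqr_sqrtr (ltW x0)) lnXn // -[leLHS]mulr_natl ler_wpM2l //.
by rewrite -[leRHS]lnK ?posrE // expR_ge_id.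
Qed.


Theorem theorem3p1 (R : realType)
  (p N : nat -> nat) (phi K s_min s_max c_min c_max c : R) (m n : nat)
  (M : ptopologicalType) (A : smooth_atlas R m M) (g : riemannian_metric A)
  (vol : {measure set (borelType M) -> \bar R})
  (PM : probability (borelType M) R)
  (iota : forall k, M -> 'cV[R]_(p k))
  (sigma : forall k, 'rV[R]_(p k)) (blocks : forall k, {set {set 'I_(p k)}})
  (d : measure_display) (T : nat -> measurableType d)
  (P : forall k, probability (T k) R)
  (X Ssamp : forall k, T k -> 'M[R]_(p k, N k))
  (Chat : forall k, T k -> 'M[R]_(p k))
  (sigma_pwc : forall k, T k -> 'rV[R]_(p k))
  (hp : p k @[k --> \oo] --> \oo)
  (hN : N k @[k --> \oo] --> \oo)
  (hphi : 0 < phi)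
  (hpN : (p k)%:R / (N k)%:R @[k --> \oo] --> phi)
  (hX : forall k, noise_matrix (P k) K (X k))
  (hs_min : 0 < s_min)
  (hsigma : forall k, piecewise_constant s_min s_max (blocks k) (sigma k))
  (hblocks : #|blocks k|%:R / (p k)%:R @[k --> \oo] --> (0 : R))
  (hblock_size : forall L : nat, \forall k \near \oo,
     forall B : {set 'I_(p k)}, B \in blocks k -> (L <= #|B|)%N)
  (hM_hausdorff : hausdorff_space M)
  (hM_compact : compact [set: M])
  (hM_connected : connected [set: M])
  (hvol : riemannian_volume g vol)
  (hc_min : 0 < c_min)
  (hPM : density_between vol PM c_min c_max)
  (hiota : forall k, isometric_embedding g (iota k))
  (hspan : forall k, linear_span_dim n (range (iota k)))
  (hS : forall k, signal_matrix (P k) PM (iota k) (Ssamp k))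
  (hSX : forall k, independent_pair (P k)
     (Ssamp k : T k -> borelType 'M[R]_(p k, N k))
     (X k : T k -> borelType 'M[R]_(p k, N k)))
  (hc : 0 < c)
  (hChat : forall k w, spectral_truncation n
     (sample_covariance (observation (sigma k) (Ssamp k w) (X k w))) (Chat k w))
  (hpwc : forall k w, potts_argmin (c * ln (p k)%:R / (N k)%:R)
     (residual_variance
        (sample_covariance (observation (sigma k) (Ssamp k w) (X k w))) (Chat k w))
     (sigma_pwc k w)) :
  exists2 C : R, 0 < C &
    exists E : forall k, set (T k),
      [/\ forall k, measurable (E k),
          P k (E k) @[k --> \oo] --> 1%E
        & forall k w, E k w ->
            (p k)%:R^-1 * sqdist (sigma_pwc k w) (sigma k)
              <= C * (ln (p k)%:R / (N k)%:R)].
Proof.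
have p_large (a : nat) : \forall k \near \oo, (a <= p k)%N by have /cvgnyPge := hp; apply.
have N_large : \forall k \near \oo, (0 < N k)%N by have /cvgnyPge := hN; apply.
pose C2 := square_mgf_constant K.
have sigma_itv k (i : 'I_(p k)) : s_min <= sigma k 0 i <= s_max.
  have [/and3P[/eqP cov _ _] _ [tau tauE]] := hsigma k.
  have : i \in finset.cover (blocks k) by rewrite cov inE.
  by case/finset.bigcupP => B BB iB; have [le ->] := tauE B BB.
(* One nonempty matrix yields the positivity of [s_max] and of [K + 1]. *)
have [k0 pk0 Nk0] : exists2 k, (0 < p k)%N & (0 < N k)%N.
  by near \oo => k; exists k; near: k; [exact: p_large 1%N | exact: N_large].
have s_max0 : 0 < s_max.
  have /andP[s1 s2] := sigma_itv k0 (Ordinal pk0).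
  exact: lt_le_trans hs_min (le_trans s1 s2).
have [L0 _ _ _] := noise_entry (hX k0) (Ordinal pk0, Ordinal Nk0).
have C20 : 0 < C2 by rewrite mulr_gt0 ?exprn_gt0 // mulr_gt0 // expR_gt0.
pose good k := [/\ (0 < p k)%N, (0 < N k)%N, 1 <= ln (p k)%:R :> R,
   phi / 2 <= (p k)%:R / (N k)%:R & (p k)%:R / (N k)%:R <= 2 * phi] /\
   8 * (K + 1) ^+ 4 * (ln (p k)%:R / (N k)%:R) <= C2.
have good_near : \forall k \near \oo, good k.
  have k8 : 0 < 8 * (K + 1) ^+ 4 by rewrite mulr_gt0 // exprn_gt0.
  pose eps := C2 / (8 * (K + 1) ^+ 4).
  have eps0 : 0 < eps by rewrite divr_gt0.
  (* [a1] ensures [ln p >= 1]. [a2] makes the square root of [p] at least [4 * phi / eps]; together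
     with [ln_le_sqrt] and [p <= 2 * phi * N] this gives [ln p <= eps * N]. *)
  pose a1 := (Num.truncn (expR 1 : R)).+1; pose a2 := (Num.truncn ((4 * phi / eps) ^+ 2)).+1.
  have le_truncn (x : R) (q : nat) : ((Num.truncn x).+1 <= q)%N -> x <= q%:R.
    move=> xq; apply: ltW; apply: lt_le_trans (truncnS_gt x) _; by rewrite ler_nat.
  near=> k.
  have p0 : (0 < p k)%N by near: k; exact: p_large.
  have N0 : (0 < N k)%N by near: k; exact: N_large.
  have ge : phi / 2 <= (p k)%:R / (N k)%:R.
    by near: k; apply: cvgr_ge hpN _ _; rewrite ltr_pdivrMr // ltr_pMr // ltr1n.
  have le : (p k)%:R / (N k)%:R <= 2 * phi.
    by near: k; apply: cvgr_le hpN _ _; rewrite ltr_pMl // ltr1n.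
  have p1 : (a1 <= p k)%N by near: k; exact: p_large.
  have p2 : (a2 <= p k)%N by near: k; exact: p_large.
  have p0' : 0 < (p k)%:R :> R by rewrite ltr0n.
  have N0' : 0 < (N k)%:R :> R by rewrite ltr0n.
  split; [split => //|].
    by rewrite -[leLHS]expRK ler_ln ?posrE ?expR_gt0 //; exact: le_truncn.
  rewrite -ler_pdivlMl // [leRHS]mulrC -/eps ler_pdivrMr //.
  set q := Num.sqrt ((p k)%:R : R).
  have q0 : 0 < q by rewrite sqrtr_gt0.
  have qq : q ^+ 2 = (p k)%:R by rewrite sqr_sqrtr // ltW.
  have q_ge : 4 * phi / eps <= q.
    have q1 : 0 <= 4 * phi / eps.
      by apply: divr_ge0; [apply: mulr_ge0 => //|]; apply: ltW.
    rewrite -ler_sqr ?nnegrE //; last exact: ltW.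
    by rewrite qq; exact: le_truncn.
  apply: (le_trans (ln_le_sqrt p0')); rewrite -/q -(ler_pM2r q0) -mulrA -expr2 qq.
  have {}le : (p k)%:R <= 2 * phi * (N k)%:R by rewrite -ler_pdivrMr.
  apply: (@le_trans _ _ (2 * (2 * phi * (N k)%:R))); first by rewrite ler_pM2l.
  have -> : 2 * (2 * phi * (N k)%:R) = 4 * phi * (N k)%:R by ring.
  rewrite [leRHS]mulrAC ler_pM2r //.
  by rewrite [leRHS]mulrC -ler_pdivrMr.
have event k : exists E : set (T k), [/\ measurable E,
    good k -> ((1 - 3 / (p k)%:R)%:E <= P k E)%E &
    forall w, E w -> (p k)%:R^-1 * sqdist (sigma_pwc k w) (sigma k) <=
      rate_constant n K s_max phi c * (ln (p k)%:R / (N k)%:R)].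
  (* For the early [k] that are not [good] the event is empty and its bound vacuous, since the claim
     ranges over all [k]. *)
  have [gk|ngk] := pselect (good k); last first.
    by exists set0; split => // /ngk.
  have [[p0 N0 lnp ge le] small] := gk.
  have sigma_itv0 i : 0 <= sigma k 0 i <= s_max.
    by have /andP[s1 ->] := sigma_itv k i; rewrite (le_trans (ltW hs_min)).
  have [E [mE PE] EF] := rate_event (hX k) (hS k) (hspan k) (ltW s_max0) sigma_itv0
    hc hphi p0 N0 lnp ge le small.
  exists E; split => // w Ew.
  exact: EF w Ew _ _ (hChat k w) (hpwc k w).
exists (rate_constant n K s_max phi c).
  exact: rate_constant_gt0.
exists (fun k => projT1 (cid (event k))); split.
- by move=> k; case: (cid (event k)) => E [].
(* [harmonic (p k)] is [1 / (p k + 1)], and [3 / p <= 6 / (p + 1)] once [p >= 1]. *)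
- have lim : ((1 - 6 * harmonic (p k))%:E : \bar R) @[k --> \oo] --> 1%E.
    apply/cvg_EFin; first by apply: nearW.
    rewrite -[X in _ --> X]subr0 -[X in _ - X](mulr0 6).
    apply: cvgB; first exact: cvg_cst.
    by apply: cvgMl_tmp; exact: (cvg_comp _ _ hp (@cvg_harmonic R)).
  apply: squeeze_cvge lim (cvg_cst _); near=> k.
  have gk : good k by near: k.
  case: (cid (event k)) => E [mE /(_ gk) PE _] /=.
  apply/andP; split; last exact: probability_le1.
  apply: le_trans PE.
  have [[p0 _ _ _ _] _] := gk; rewrite lee_fin lerD2l lerN2 /harmonic.
  have p1 : 1 <= (p k)%:R :> R by rewrite ler1n.
  rewrite ler_pdivrMr ?ltr0n // mulrAC ler_pdivlMr ?ltr0n // -natr1; lra.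
- by move=> k w; case: (cid (event k)) => E [? ? EF] /=; exact: EF.
Unshelve. all: by end_near.
Qed.
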